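(* Let $m,n\ge1$ be integers, let $1<p_1,\dots,p_m<\infty$ and let $p$ be defined by $\frac1p=\frac1{p_1}+\cdots+\frac1{p_m}$. Let $\mu$ be a Borel measure on $\mathbb{R}^{n+1}_+$, let $\overrightarrow{\omega}=(\omega_1,\dots,\omega_m)$ be weights on $\mathbb{R}^n$, and put $\sigma_i=\omega_i^{1-p_i'}$. If $(\mu,\overrightarrow{\omega})$ satisfies the $B'_{\overrightarrow{p}}$ condition, then the following statements hold: (1) There exists a positive constant $C$ such that $$\|\mathfrak{M}(f_1,\dots,f_m)\|_{L^p(\mathbb{R}^{n+1}_+,\mu)}\le C\prod_{i=1}^m\|f_i\|_{L^{p_i}(\mathbb{R}^n,\omega_i)}\qquad\text{for all } f_i\in L^{p_i}(\mathbb{R}^n,\omega_i),\ i=1,\dots,m.$$ (2) There exists a positive constant $C$ such that $$\|\mathfrak{M}(f_1\sigma_1,\dots,f_m\sigma_m)\|_{L^p(\mathbb{R}^{n+1}_+,\mu)}\le C\prod_{i=1}^m\|f_i\|_{L^{p_i}(\mathbb{R}^n,\sigma_i)}\qquad\text{for all } f_i\in L^{p_i}(\mathbb{R}^n,\sigma_i),\ i=1,\dots,m.$$ Moreover, denoting the smallest constants $C$ in (1) and (2) by $\|\mathfrak{M}\|$ and $\|\mathfrak{M}\|'$ respectively, one has $$\|\mathfrak{M}\|=\|\mathfrak{M}\|'\le c\,[\mu,\overrightarrow{\omega}]_{B'_{\overrightarrow{p}}},$$ where $c>0$ is a constant depending only on $n,m,p_1,\dots,p_m$.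
   Context: A weight on $\mathbb{R}^n$ is a nonnegative locally integrable function. $\|f\|_{L^{q}(\mathbb{R}^n,\omega)}=(\int_{\mathbb{R}^n}|f|^q\omega\,dx)^{1/q}$. All cubes $Q\subset\mathbb{R}^n$ have sides parallel to the coordinate axes, $|Q|$ is Lebesgue measure, $l(Q)$ is the side length. $p_i'=p_i/(p_i-1)$, and $\sigma(Q)=\int_Q\sigma\,dx$. $\mathbb{R}^{n+1}_+=\{(x,t):x\in\mathbb{R}^n,\ t\ge0\}$, and for a cube $Q\subset\mathbb{R}^n$, $\widetilde{Q}=\{(x,t)\in\mathbb{R}^{n+1}_+:x\in Q,\ 0\le t<l(Q)\}$. The multilinear maximal operator on the upper half-space is $$\mathfrak{M}(f_1,\dots,f_m)(x,t)=\sup_{Q\ni x,\ l(Q)\ge t}\ \prod_{i=1}^m\frac1{|Q|}\int_Q|f_i(y_i)|\,dy_i,$$ the supremum being over cubes $Q\subset\mathbb{R}^n$ with $x\in Q$ and $l(Q)\ge t$. With $\sigma_i=\omega_i^{1-p_i'}$, $(\mu,\overrightarrow{\omega})$ satisfies the $B'_{\overrightarrow{p}}$ condition if $$[\mu,\overrightarrow{\omega}]_{B'_{\overrightarrow{p}}}=\sup_Q\left(\frac{\mu(\widetilde{Q})}{|Q|}\right)^{1/p}\prod_{i=1}^m\frac{\sigma_i(Q)}{|Q|}\,\exp\left(\frac1{|Q|}\int_Q\log\prod_{i=1}^m\sigma_i^{-1/p_i}\,dx\right)<\infty,$$ the supremum being over all cubes $Q$ in $\mathbb{R}^n$.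
   Formalization: In the B' constant, a product of an infinite σ-average with a vanishing exponential factor is read as +∞ (under 0·∞=0 the claim fails for ω=0), and the smallest constants are taken among C ≥ 0, since for μ=0 no smallest positive constant exists. *)

(* Defs.v *)
From HB Require Import structures.
From mathcomp Require Import all_boot all_order all_algebra.
From mathcomp Require Import all_classical all_reals all_analysis.

Set Implicit Arguments.
Unset Strict Implicit.
Unset Printing Implicit Defensive.

Import Order.TTheory GRing.Theory Num.Theory.
Import numFieldNormedType.Exports.

Local Open Scope classical_set_scope.
Local Open Scope ring_scope.

(* The sigma-algebra on n.-tuple is the product one, i.e. the Borel sets of
   R^n. *)
Notation Rn R n := (n.-tuple (measurableTypeR R)).

Section cons_measure.
Context {R : realType}.
Local Open Scope ereal_scope.

Definition Rn_cons n (z : measurableTypeR R * Rn R n) : Rn R n.+1 :=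
  [the n.+1.-tuple _ of z.1 :: z.2].

Variables (n : nat) (m : {sigma_finite_measure set (Rn R n) -> \bar R}).

Definition cons_measure : set (Rn R n.+1) -> \bar R :=
  pushforward (lebesgue_measure \x m) (@Rn_cons n).

Let mcons : measurable_fun [set: _] (@Rn_cons n).
Proof. exact: measurable_cons. Qed.

Let cons_measure0 : cons_measure set0 = 0.
Proof. by rewrite /cons_measure /pushforward preimage_set0 measure0. Qed.

Let cons_measure_ge0 A : 0 <= cons_measure A.
Proof. exact: measure_ge0. Qed.

Let cons_measure_sigma_additive : semi_sigma_additive cons_measure.
Proof.
move=> F mF tF mUF; rewrite /cons_measure /pushforward preimage_bigcup.
apply: measure_semi_sigma_additive.
- by move=> k; rewrite -[X in measurable X]setTI; exact: mcons.
- apply/trivIsetP => /= i j _ _ ij; rewrite -preimage_setI.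
  by move/trivIsetP : tF => /(_ _ _ _ _ ij) ->//; rewrite preimage_set0.
- by rewrite -preimage_bigcup -[X in measurable X]setTI; exact: mcons.
Qed.

HB.instance Definition _ := isMeasure.Build _ _ _ cons_measure
  cons_measure0 cons_measure_ge0 cons_measure_sigma_additive.

Let cons_measure_sigma_finite : sigma_finite setT cons_measure.
Proof.
have /sigma_finiteP[F [TF ndF Foo]] := sigma_finiteT (@lebesgue_measure R).
have /sigma_finiteP[G [TG ndG Goo]] := sigma_finiteT m.
pose g (x : Rn R n.+1) : (measurableTypeR R * Rn R n)%type :=
  (thead x, [tuple of behead x]).
have mg : measurable_fun setT g.
  apply/measurable_fun_pair; first exact: measurable_tnth.
  exact: measurable_behead.
have gK : cancel (@Rn_cons n) g.
  by move=> [x y]; rewrite /g theadE; congr pair; exact: val_inj.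
exists (fun k => g @^-1` (F k `*` G k)).
  rewrite -preimage_bigcup; apply/esym/seteqP; split => // x _.
  have : [set: measurableTypeR R] (g x).1 by [].
  have : [set: Rn R n] (g x).2 by [].
  rewrite {1}TG {1}TF => -[j _ Gj] [i _ Fi].
  exists (maxn i j) => //; split.
    by move: (g x).1 Fi; exact/subsetPset/ndF/leq_maxl.
  by move: (g x).2 Gj; exact/subsetPset/ndG/leq_maxr.
move=> k; have [mF Fk] := Foo k; have [mG Gk] := Goo k; split.
  by rewrite -[X in measurable X]setTI; apply: mg => //; exact: measurableX.
rewrite /cons_measure /pushforward -comp_preimage (_ : g \o _ = id).
  by rewrite preimage_id product_measure1E// lte_mul_pinfty// ge0_fin_numE.
by apply/funext => z; exact: gK.
Qed.

HB.instance Definition _ := Measure_isSigmaFinite.Build _ _ _ cons_measure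
  cons_measure_sigma_finite.

End cons_measure.

(* Lebesgue measure on R^n, as the n-fold product of Lebesgue measure on R. *)
Fixpoint lebesgue_Rn (R : realType) (n : nat) :
    {sigma_finite_measure set (Rn R n) -> \bar R} :=
  match n with
  | 0 => \d_ ([tuple] : Rn R 0)
  | n'.+1 => cons_measure (lebesgue_Rn R n')
  end.

Section definitions.
Context {R : realType} {n : nat}.
Implicit Types (x : Rn R n) (a : Rn R n) (l t : R) (Q : set (Rn R n)).
Local Open Scope ereal_scope.

Local Notation leb := (lebesgue_Rn R n).

(* Compactness is the one of the topology of 'rV[R]_n, since n.-tuple carries
   no topology in the library. *)
Definition compact_Rn (K : set (Rn R n)) : Prop :=
  compact [set v : 'rV[R]_n | K [tuple v ord0 i | i < n]].

Definition weight (w : Rn R n -> R) : Prop :=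
  [/\ measurable_fun setT w, forall x, (0 <= w x)%R &
      forall K, compact_Rn K -> \int[leb]_(x in K) (w x)%:E < +oo].

(* (\int |f|^q v)^(1/q), also meaningful for v with values in [0, +oo]. *)
Definition weighted_norm (q : R) (v : Rn R n -> \bar R) (f : Rn R n -> R) :
    \bar R :=
  (\int[leb]_x (`|f x|%:E `^ q * v x)) `^ q^-1.

Definition weighted_Lp (q : R) (v : Rn R n -> \bar R) (f : Rn R n -> R) :
    Prop :=
  measurable_fun setT f /\ weighted_norm q v f < +oo.

Definition cube a l : set (Rn R n) :=
  [set x | forall i, (tnth a i <= tnth x i <= tnth a i + l)%R].

(* Points (x, t) with t < 0 exist in the type but are never used: the closed
   upper half-space is the following subset, and a Borel measure on it is the
   restriction of a Borel measure on R^n x R. *)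
Definition half_space : set (Rn R n * measurableTypeR R) :=
  [set z | (0 <= z.2)%R].

Definition cube_tent a l : set (Rn R n * measurableTypeR R) :=
  [set z | cube a l z.1 /\ (0 <= z.2 < l)%R].

Definition half_space_norm
    (mu : {measure set (Rn R n * measurableTypeR R) -> \bar R}) (q : R)
    (F : Rn R n * measurableTypeR R -> \bar R) : \bar R :=
  (\int[mu]_(z in half_space) (`|F z| `^ q)) `^ q^-1.

Definition avg (f : Rn R n -> \bar R) a l : \bar R :=
  (\int[leb]_(x in cube a l) f x) / leb (cube a l).

Definition maximal m (f : 'I_m -> Rn R n -> \bar R)
    (z : Rn R n * measurableTypeR R) : \bar R :=
  ereal_sup [set y | exists a l, [/\ (0 < l)%R, cube a l z.1, (z.2 <= l)%R &
    y = \prod_(i < m) avg (fun x => `|f i x|) a l]].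

(* Real powers of x in [0, +oo] with 0^r = +oo and +oo^r = 0 for r < 0 (the
   library has 0 `^ r = 0 and +oo `^ r = +oo for these r). *)
Definition epow (x : \bar R) (r : R) : \bar R :=
  if (r < 0)%R then (x `^ (- r))^-1 else x `^ r.

Definition conj_exponent (q : R) : R := (q / (q - 1))%R.

Definition dual_weight (q : R) (w : Rn R n -> R) (x : Rn R n) : \bar R :=
  epow (w x)%:E (1 - conj_exponent q).

(* The product, except that +oo * 0 = +oo when the left factor is +oo. *)
Definition mule_oo (x y : \bar R) : \bar R :=
  if x == +oo then +oo else x * y.

(* The quantity [mu, w]_{B'_p}. The indeterminate case of the last product is
   prod_i sigma_i(Q) = +oo with a vanishing exponential. It is read as +oo, the
   limit of its values for the truncated weights min(sigma_i, k) (Jensen);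
   with the value 0, the zero weight would have constant 0 for every mu. *)
Definition B'_const m (ps : 'I_m -> R) (p : R)
    (mu : {measure set (Rn R n * measurableTypeR R) -> \bar R})
    (w : 'I_m -> Rn R n -> R) : \bar R :=
  let sigma i := dual_weight (ps i) (w i) in
  ereal_sup [set y | exists a l, (0 < l)%R /\
    y = (mu (cube_tent a l) / leb (cube a l)) `^ p^-1 *
        mule_oo (\prod_(i < m) avg (sigma i) a l)
          (expeR (avg (fun x =>
             lne (\prod_(i < m) epow (sigma i x) (- (ps i)^-1))) a l))].

Definition B'_condition m (ps : 'I_m -> R) (p : R)
    (mu : {measure set (Rn R n * measurableTypeR R) -> \bar R})
    (w : 'I_m -> Rn R n -> R) : Prop :=
  B'_const ps p mu w < +oo.

Definition strong_bound m (ps : 'I_m -> R) (p : R)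
    (mu : {measure set (Rn R n * measurableTypeR R) -> \bar R})
    (w : 'I_m -> Rn R n -> R) (C : R) : Prop :=
  let v i x := (w i x)%:E in
  forall f : 'I_m -> Rn R n -> R,
    (forall i, weighted_Lp (ps i) (v i) (f i)) ->
    half_space_norm mu p (maximal (fun i x => (f i x)%:E)) <=
      C%:E * \prod_(i < m) weighted_norm (ps i) (v i) (f i).

Definition dual_strong_bound m (ps : 'I_m -> R) (p : R)
    (mu : {measure set (Rn R n * measurableTypeR R) -> \bar R})
    (w : 'I_m -> Rn R n -> R) (C : R) : Prop :=
  let sigma i := dual_weight (ps i) (w i) in
  forall f : 'I_m -> Rn R n -> R,
    (forall i, weighted_Lp (ps i) (sigma i) (f i)) ->
    half_space_norm mu p (maximal (fun i x => (f i x)%:E * sigma i x)) <=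
      C%:E * \prod_(i < m) weighted_norm (ps i) (sigma i) (f i).

(* The value 0 is allowed: it is the smallest constant when mu = 0. *)
Definition smallest_constant (P : R -> Prop) (N : R) : Prop :=
  [/\ (0 <= N)%R, P N & forall C, (0 <= C)%R -> P C -> (N <= C)%R].

End definitions.

(* Main.v *)
Require Import Defs.
From mathcomp Require Import all_boot all_order all_algebra.
From mathcomp Require Import all_classical all_reals all_analysis.
From mathcomp Require Import measurable_realfun ring lra.

(* The one-third trick replaces arbitrary cubes by the dyadic cubes of finitely
   many shifted grids, and Fatou's lemma allows each grid to be a finite tree.
   Stopping where prod_i avg_S |f_i| has grown by a fixed factor dominates the
   dyadic maximal operator by a sparse sum of mu(tent S) (prod_i avg_S |f_i|)^p.
   By the B'_p condition, the inequality exp(avg log sigma) <=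
   (avg sqrt(sigma))^2 and the weighted AM-GM inequality, this sum splits into
   one sum of |S| H_i(S) for each weight, where
   H_i(S) = (avg_S sqrt(sigma_i))^2 (int_S |f_i| / sigma_i(S))^p_i.
   Sparseness bounds it by the integral of sup_S H_i(S), and a Bellman function
   bounds the latter by a multiple of the integral of |f_i|^p_i w_i.
   If some sigma_i(Q) is infinite, then mu vanishes on the half-space. Otherwise
   w_i > 0 almost everywhere and f_i |-> f_i sigma_i exchanges (1) and (2). *)

Set Implicit Arguments.
Unset Strict Implicit.
Unset Printing Implicit Defensive.

Import Order.TTheory GRing.Theory Num.Theory.

Local Open Scope classical_set_scope.
Local Open Scope ring_scope.

(** * Sparse sums on finite trees *)

(** The obstacle is that the sparse family retains a fixed fraction of |S| only, and nothing is
    known about the corresponding fraction of sigma_i(S). The exponential in B'_p must make up for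
    this. The square root is a convenient power below 1: its averages dominate the geometric mean,
    and Doob's inequality in L^2 bounds the integral of sup_S (avg_S sqrt(sigma_i))^2 by 4 times
    that of sigma_i, through a quadratic supersolution. H_i multiplies this quantity by a power of
    the sigma_i-average of |f_i| / sigma_i. The suprema of the two factors are controlled with
    respect to different measures, so they cannot be estimated separately. The Bellman function
    therefore freezes the second factor until it has grown by a fixed ratio and then restarts the
    L^2 argument. On an abstract tree this takes only additivity of the node quantities and two
    Young inequalities, one for sqrt(sigma_i) and one for f_i; the integrals later supply both. The
    AM-GM inequality is applied to H_i divided by the integral of |f_i|^p_i w_i, which keeps the
    final bound in product form. *)

Lemma le_powR_base (R : realType) (r x y : R) : 0 <= r -> 0 <= x -> x <= y ->
  x `^ r <= y `^ r.
Proof.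
move=> r0 x0 xy; apply: ge0_ler_powR => //; rewrite nnegrE //.
exact: le_trans xy.
Qed.

Lemma powR_prod (R : realType) (I : finType) (x : I -> R) (r : R) :
  (forall i, 0 <= x i) -> (\prod_i x i) `^ r = \prod_i x i `^ r.
Proof.
move=> x0; suff [] : 0 <= \prod_i x i /\ (\prod_i x i) `^ r = \prod_i x i `^ r by [].
elim/big_rec2: _ => [|i u v _ [v0 <-]]; first by rewrite ler01 powR1.
by rewrite mulr_ge0// powRM.
Qed.

(** With [S] the weighted mean, [x i / S] is at most the exponential of [x i / S - 1]; in the
    product of the powers [th i] the exponents add up to 0. *)
Lemma weighted_AMGM (R : realType) (I : finType) (th x : I -> R) :
  (forall i, 0 < th i) -> \sum_i th i = 1 -> (forall i, 0 <= x i) ->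
  \prod_i x i `^ th i <= \sum_i th i * x i.
Proof.
move=> th0 th1 x0; pose S := \sum_i th i * x i.
have S0 : 0 <= S by apply: sumr_ge0 => i _; rewrite mulr_ge0// ltW.
have [S00|Sneq0] := eqVneq S 0.
  have [i _|none] := pickP (fun i : I => true); last first.
    by exfalso; have := oner_neq0 R; rewrite -th1 big_pred0 ?eqxx.
  have /eqP : S = 0 by [].
  rewrite psumr_eq0 => [/allP/(_ i)|j _]; last by rewrite mulr_ge0// ltW.
  rewrite mem_index_enum => /(_ isT)/eqP/eqP; rewrite mulf_eq0 gt_eqF//= => /eqP xi.
  by rewrite (bigD1 i)//= xi powR0 ?mul0r ?gt_eqF// .
have Sgt0 : 0 < S by rewrite lt_neqAle eq_sym Sneq0.
have expS i : (x i / S) `^ th i <= expR (th i * (x i / S - 1)).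
  rewrite (mulrC (th i)) expRM; apply: le_powR_base; rewrite ?divr_ge0 //; try exact: ltW.
  by rewrite -[leLHS](subrKC 1) expR_ge1Dx.
have le1 : \prod_i (x i / S) `^ th i <= 1.
  apply: (@le_trans _ _ (\prod_i expR (th i * (x i / S - 1)))).
    by apply: ler_prod => i _; rewrite powR_ge0 expS.
  rewrite -expR_sum -[leRHS]expR0 ler_expR.
  under eq_bigr do rewrite mulrBr mulr1 mulrA.
  by rewrite sumrB th1 -mulr_suml -/S divff// subrr.
have SE : \prod_i S `^ th i = S.
  rewrite (eq_bigr (fun i => expR (th i * ln S))) => [|i _].
    by rewrite -expR_sum -mulr_suml th1 mul1r lnK.
  by rewrite /powR gt_eqF// .
rewrite -/S (eq_bigr (fun i => (x i / S) `^ th i * S `^ th i)) => [|i _].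
  by rewrite big_split/= SE -[leRHS]mul1r ler_wpM2r.
by rewrite -powRM ?divr_ge0// divfK.
Qed.

Section tree.
Context {R : realType} {T : Type} {C : finType}.
Variable ch : C -> T -> T.
Implicit Types (k : nat) (s : T).

Definition tree_additive (A : T -> R) := forall s, A s = \sum_c A (ch c s).

(** For additive [vol] this is the integral over [s] of the larger of [v] and the supremum of [H]
    over generations 0 to [k], where [H] is viewed as constant on each node. *)
Fixpoint max_sum (vol H : T -> R) k v s : R :=
  let v' := Num.max v (H s) in
  if k is k'.+1 then \sum_c max_sum vol H k' v' (ch c s) else v' * vol s.

Lemma le_max_sum (vol H : T -> R) k u v s : (forall s, 0 <= vol s) -> u <= v ->
  max_sum vol H k u s <= max_sum vol H k v s.
Proof.
move=> vol0; elim: k u v s => [|k IH] u v s uv /=; last first.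
  by apply: ler_sum => c _; apply: IH; rewrite ge_max !le_max uv lexx orbT.
by rewrite ler_wpM2r// ge_max !le_max uv lexx orbT.
Qed.

(** * A Bellman function for the integral of sup H *)

Section maximal_carleson.
Variables (q : R) (vol sg h F X : T -> R).
Hypothesis q1 : 1 < q.

(* [t0 * y < y'] implies [2 * y `^ (q - 1) <= y' `^ (q - 1)]. *)
Let t0 : R := 2 `^ (q - 1)^-1.
Let t : R := t0 `^ q.
(** Chosen so that [b / 2 - 1 = 4 * t], the amount by which [D] has to drop at a restart. *)
Definition carleson_cst : R := 2 * (1 + 4 * t).
Local Notation b := carleson_cst.

Hypotheses (vol0 : forall s, 0 < vol s) (sg0 : forall s, 0 < sg s).
Hypotheses (h0 : forall s, 0 <= h s) (F0 : forall s, 0 <= F s).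
Hypotheses (addvol : tree_additive vol) (addsg : tree_additive sg).
Hypotheses (addh : tree_additive h) (addF : tree_additive F).
Hypothesis addX : tree_additive X.
Hypothesis young_h : forall s (w : R), 0 <= w -> 4 * w * h s <= 4 * sg s + w ^+ 2 * vol s.
Hypothesis young_F : forall s (y : R), 0 <= y ->
  b * y `^ (q - 1) * F s <= b `^ q * X s + y `^ q * sg s.

Let H s := (h s / vol s) ^+ 2 * (F s / sg s) `^ q.
Let E w s := 4 * sg s + 2 * w ^+ 2 * vol s - 4 * w * h s.
Let D y s := b `^ q * X s + y `^ q * sg s - b * y `^ (q - 1) * F s.

Let q0 : 0 < q. Proof. by apply: lt_trans q1. Qed.
Let q10 : 0 < q - 1. Proof. by rewrite subr_gt0. Qed.
Let t00 : 0 < t0. Proof. exact: powR_gt0. Qed.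
Let tgt0 : 0 < t. Proof. exact: powR_gt0. Qed.
Let tge1 : 1 <= t.
Proof.
have ge1 (x r : R) : 1 <= x -> 0 <= r -> 1 <= x `^ r.
  by move=> x1 r0; have := le_powR_base r0 ler01 x1; rewrite powR1.
apply: (ge1 _ _ _ (ltW q0)); apply: ge1; first by rewrite ler1n.
by rewrite invr_ge0 ltW.
Qed.
Let t02 : t0 `^ (q - 1) = 2.
Proof. by rewrite /t0 -powRrM mulVf ?powRr1 ?ler0n ?gt_eqF. Qed.

Let sumE w s : \sum_c E w (ch c s) = E w s.
Proof. by rewrite /E !big_split/= sumrN -!mulr_sumr -addsg -addvol -addh. Qed.

Let sumD y s : \sum_c D y (ch c s) = D y s.
Proof. by rewrite /D !big_split/= sumrN -!mulr_sumr -addsg -addX -addF. Qed.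

Let D0 y s : 0 <= y -> 0 <= D y s.
Proof. by move=> y0; rewrite /D subr_ge0 young_F. Qed.

Let E_ge w s : 0 <= w -> w ^+ 2 * vol s <= E w s.
Proof. by move=> w0; rewrite /E; have := young_h s w0; lra. Qed.

(** As a function of [w], [E w s] is a parabola with vertex at [h s / vol s], so raising [w] to the
    vertex lowers it. *)
Let E_max w s : E (Num.max w (h s / vol s)) s <= E w s.
Proof.
rewrite /Num.max; case: ifPn => // _; rewrite -subr_ge0 /E.
have v0 : vol s != 0 by rewrite gt_eqF.
rewrite [X in 0 <= X](_ : _ = 2 * vol s * (w - h s / vol s) ^+ 2); last by field.
by rewrite mulr_ge0 ?sqr_ge0// mulr_ge0// ltW.
Qed.

Let E_self s : E (h s / vol s) s <= 4 * sg s.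
Proof.
have v0 : vol s != 0 by rewrite gt_eqF.
rewrite -subr_ge0 /E.
rewrite [X in 0 <= X](_ : _ = 2 * vol s * (h s / vol s) ^+ 2); last by field.
by rewrite mulr_ge0 ?sqr_ge0// mulr_ge0// ltW.
Qed.

(** The term of [D] that is linear in [F] has modulus [b * y' ^ q * sg s] at [y'], and at most half
    of that at [y], because the power [q - 1] has at least doubled. The difference pays for
    restarting [E], which costs [4 * t * y' ^ q * sg s]. *)
Let D_step y s (y' := F s / sg s) : 0 <= y -> t0 * y < y' ->
  4 * t * y' `^ q * sg s + D y' s <= D y s.
Proof.
move=> y0 yy'; have y'0 : 0 <= y' by rewrite (le_trans _ (ltW yy'))// mulr_ge0// ltW.
have Fs : F s = y' * sg s by rewrite /y' divfK// gt_eqF.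
rewrite /D Fs; clearbody y'; rewrite -(mulr_powRB1 y'0 q0).
have H1 : 2 * y `^ (q - 1) <= y' `^ (q - 1).
  rewrite -t02 -powRM//; last exact: ltW.
  by apply: le_powR_base; rewrite ?mulr_ge0// ltW.
have H2 : 0 <= y `^ q * sg s by rewrite mulr_ge0 ?powR_ge0// ltW.
have H3 : b * (y' * sg s) * (2 * y `^ (q - 1)) <= b * (y' * sg s) * y' `^ (q - 1).
  rewrite ler_wpM2l//; apply: mulr_ge0; last by rewrite mulr_ge0// ltW.
  by rewrite mulr_ge0// addr_ge0// mulr_ge0// ltW.
have -> : 4 * t * (y' * y' `^ (q - 1)) * sg s =
    (b / 2 - 1) * (y' * sg s) * y' `^ (q - 1) by rewrite /b; field.
move: H1 H2 H3; set P := y' `^ _; set Q := y `^ (q - 1); set S := y `^ q * _.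
set V := b `^ q * _; set W := y' * sg s => H1 H2 H3; clearbody P Q S V.
have -> : y' * P * sg s = W * P by rewrite /W; ring.
lra.
Qed.

Let bellman_step y w z v s (r : R) : 0 <= y -> 0 <= w -> 0 <= z -> 0 <= v ->
  v <= z + t * y `^ q * w ^+ 2 ->
  (forall y1 w1 z1, 0 <= y1 -> 0 <= w1 -> 0 <= z1 ->
    Num.max v (H s) <= z1 + t * y1 `^ q * w1 ^+ 2 ->
    r <= z1 * vol s + t * y1 `^ q * E w1 s + D y1 s) ->
  r <= z * vol s + t * y `^ q * E w s + D y s.
Proof.
move=> y0 w0 z0 v0 vz step; pose y' := F s / sg s; pose w' := h s / vol s.
have w'0 : 0 <= w' by rewrite divr_ge0// ltW.
have y'0 : 0 <= y' by rewrite divr_ge0// ltW.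
have HE : H s = w' ^+ 2 * y' `^ q by [].
have [yy'|yy'] := ltP (t0 * y) y'.
  (* Restart: the old bound [t * y ^ q * w ^ 2] is moved into [z], and [E] starts again from the
     average [w']. *)
  have vz' : Num.max v (H s) <=
      (z + t * y `^ q * w ^+ 2) + t * y' `^ q * w' ^+ 2.
    rewrite ge_max; apply/andP; split.
      apply: (le_trans vz); rewrite lerDl mulr_ge0 ?sqr_ge0//.
      by rewrite mulr_ge0 ?powR_ge0// ltW.
    rewrite HE -[leLHS]add0r lerD//; first exact: le_trans vz.
    by rewrite mulrC ler_wpM2r ?sqr_ge0// ler_peMl ?powR_ge0.
  have z'0 : 0 <= z + t * y `^ q * w ^+ 2 by apply: le_trans vz.
  apply: le_trans (step _ _ _ y'0 w'0 z'0 vz') _.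
  have H1 := D_step y0 yy'; rewrite -/y' in H1.
  have H2 := E_ge s w0.
  have H3 : t * y' `^ q * E w' s <= t * y' `^ q * (4 * sg s).
    by rewrite ler_wpM2l ?E_self// mulr_ge0 ?powR_ge0// ltW.
  have H4 : t * y `^ q * (w ^+ 2 * vol s) <= t * y `^ q * E w s.
    by rewrite ler_wpM2l// mulr_ge0 ?powR_ge0// ltW.
  lra.
(* No restart: [y'] is at most [t0 * y], hence [y' ^ q <= t * y ^ q], which is why the invariant
   carries the factor [t]. *)
pose w'' := Num.max w w'.
have ww'' : w <= w'' by rewrite le_max lexx.
have w'w'' : w' <= w'' by rewrite le_max lexx orbT.
have w''0 : 0 <= w'' by apply: le_trans ww''.
have ty0 : 0 <= t * y `^ q by rewrite mulr_ge0 ?powR_ge0// ltW.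
have vz' : Num.max v (H s) <= z + t * y `^ q * w'' ^+ 2.
  have wz : z + t * y `^ q * w ^+ 2 <= z + t * y `^ q * w'' ^+ 2.
    by rewrite lerD2l ler_wpM2l// lerXn2r.
  rewrite ge_max (le_trans vz wz) HE /=.
  rewrite -[leLHS]add0r lerD//.
  have yq : y' `^ q <= t * y `^ q.
    rewrite /t -powRM//; last exact: ltW.
    by apply: le_powR_base => //; exact: ltW.
  apply: (@le_trans _ _ (w' ^+ 2 * (t * y `^ q))).
    by rewrite ler_wpM2l ?sqr_ge0.
  by rewrite mulrC ler_wpM2l// lerXn2r.
apply: le_trans (step _ _ _ y0 w''0 z0 vz') _.
by rewrite lerD2r lerD2l ler_wpM2l// E_max.
Qed.

(* A Bellman function for the maximal operator: [E] is Doob's supersolution for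
   the averages of [h], restarted whenever the [sg]-average of [F] exceeds [t0]
   times its value [y] at the last restart, and [D] pays for the restarts. *)
Let bellman k y w z v s : 0 <= y -> 0 <= w -> 0 <= z -> 0 <= v ->
  v <= z + t * y `^ q * w ^+ 2 ->
  max_sum vol H k v s <= z * vol s + t * y `^ q * E w s + D y s.
Proof.
elim: k y w z v s => [|k IH] y w z v s y0 w0 z0 v0 vz.
  apply: (bellman_step y0 w0 z0 v0 vz) => y1 w1 z1 y10 w10 z10 vz1 /=.
  rewrite -[leLHS]addr0 lerD ?D0//.
  apply: (le_trans (ler_wpM2r (ltW (vol0 s)) vz1)).
  rewrite mulrDl lerD2l -(mulrA (t * _)).
  by rewrite ler_wpM2l ?E_ge// mulr_ge0 ?powR_ge0// ltW.
apply: (bellman_step y0 w0 z0 v0 vz) => y1 w1 z1 y10 w10 z10 vz1 /=.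
apply: (@le_trans _ _ (\sum_c
    (z1 * vol (ch c s) + t * y1 `^ q * E w1 (ch c s) + D y1 (ch c s)))).
  by apply: ler_sum => c _; apply: IH => //; rewrite le_max v0.
by rewrite big_split big_split /= -!mulr_sumr -addvol sumE sumD.
Qed.

(** At the initial state, where all parameters are 0, the Bellman function reduces to [D 0 s], which
    is the right-hand side. *)
Lemma le_max_sum_carleson k s : max_sum vol H k 0 s <= b `^ q * X s.
Proof.
apply: le_trans (bellman k s (lexx 0) (lexx 0) (lexx 0) (lexx 0) _) _.
  by rewrite !(mul0r, powR0, mulr0, add0r, expr0n)// gt_eqF.
by rewrite /D !(mul0r, powR0, mulr0, add0r, subr0, addr0)// gt_eqF.
Qed.

End maximal_carleson.

(** * Stopping nodes and sparse sums *)

Section sparse.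
Variables (m : nat) (p : R) (ps : 'I_m -> R).
Variables (vol M : T -> R) (F : 'I_m -> T -> R).
Hypotheses (vol0 : forall s, 0 < vol s) (addvol : tree_additive vol).
Hypotheses (F0 : forall i s, 0 <= F i s) (addF : forall i, tree_additive (F i)).

Definition avg_prod s := \prod_i (F i s / vol s).

(** If a product of [m] averages grows by more than this factor, one of them has grown by more than
    [2 * m]. The nodes where a given average has done so fill at most [1 / (2 * m)] of the stopping
    ancestor, hence all of them together at most half. *)
Definition stop_ratio : R := (2 * m%:R) ^+ m.

(* [u] is the value of [avg_prod] at the last stopping ancestor, [k] the number
   of remaining generations. *)
Fixpoint sparse_sum (f : T -> R) k u s : R :=
  let next w := if k is k'.+1 then \sum_c sparse_sum f k' w (ch c s) else 0 in
  if stop_ratio * u < avg_prod s then f s + next (avg_prod s) else next u.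

Lemma avg_prod_ge0 s : 0 <= avg_prod s.
Proof. by apply: prodr_ge0 => i _; rewrite divr_ge0// ltW. Qed.

Lemma stop_ratio_ge0 : 0 <= stop_ratio.
Proof. by rewrite exprn_ge0// mulr_ge0. Qed.

Lemma avg_prod_jump (r : 'I_m -> R) s : (forall i, 0 < r i) ->
  stop_ratio * \prod_i r i < avg_prod s ->
  vol s <= \sum_i F i s / (2 * m%:R * r i).
Proof.
move=> r0 jump; have [m0|mpos] := posnP m.
  move: jump; rewrite /stop_ratio /avg_prod.
  rewrite [X in _ * X]big1 ?[X in _ < X]big1 ?mulr1; last 2 first.
  - by move=> i _; move: (ltn_ord i); rewrite {2}m0.
  - by move=> i _; move: (ltn_ord i); rewrite {2}m0.
  by rewrite {2}m0 expr0 ltxx.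
have mgt0 : (0 : R) < 2 * m%:R by rewrite mulr_gt0// ltr0n.
have [/existsP[i ri]|] := boolP [exists i, 2 * m%:R * r i <= F i s / vol s].
  rewrite (bigD1 i)//= -[leLHS]addr0 lerD//; last first.
    by apply: sumr_ge0 => j _; rewrite divr_ge0// mulr_ge0 ?ltW.
  have mri : 0 < 2 * m%:R * r i by rewrite mulr_gt0.
  by rewrite ler_pdivlMr// mulrC -ler_pdivlMr.
rewrite negb_exists => /forallP noi; exfalso; move: jump; apply/negP.
rewrite -leNgt /avg_prod /stop_ratio.
have -> : (2 * m%:R : R) ^+ m = \prod_(i < m) (2 * m%:R).
  by rewrite prodr_const card_ord.
rewrite -big_split/=; apply: ler_prod => i _.
rewrite divr_ge0//=; last exact: ltW.
by apply: ltW; rewrite ltNge.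
Qed.

(* The descendants at which one stops next below a stopping node with averages
   [r] have total measure at most [\sum_i F i s / (2 * m%:R * r i)], half of the
   measure of that node. This term turns sparseness into an induction. *)
Lemma sparse_sum_step (H : T -> R) (nx : R -> R) (ms u v : R)
    (r : 'I_m -> R) s : 0 <= H s -> 0 <= u -> 0 <= v ->
  v = 0 \/ (u = \prod_i r i /\ forall i, 0 < r i) ->
  (forall u1 v1 (r1 : 'I_m -> R), 0 <= u1 -> 0 <= v1 <= Num.max v (H s) ->
    v1 = 0 \/ (u1 = \prod_i r1 i /\ forall i, 0 < r1 i) ->
    nx u1 <= 2 * ms - 2 * v1 * vol s +
      2 * v1 * \sum_i F i s / (2 * m%:R * r1 i)) ->
  (if stop_ratio * u < avg_prod s then vol s * H s + nx (avg_prod s) else nx u)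
    <= 2 * ms - 2 * v * vol s + 2 * v * \sum_i F i s / (2 * m%:R * r i).
Proof.
move=> H0 u0 v0 vr nxP; case: ifPn => jump; last first.
  by apply: nxP => //; rewrite v0/= le_max lexx.
pose v' := Num.max v (H s); pose r' i := F i s / vol s.
have Hv' : H s <= v' by rewrite le_max lexx orbT.
have v'0 : 0 <= v' by apply: le_trans Hv'.
have avg0 : 0 < avg_prod s.
  by apply: le_lt_trans jump; rewrite mulr_ge0// stop_ratio_ge0.
have r'0 i : 0 < r' i.
  rewrite lt_neqAle divr_ge0 ?andbT ?(ltW (vol0 _))// eq_sym.
  by have := gt_eqF avg0; rewrite /avg_prod => /negbT/prodf_neq0/(_ i isT).
have half : 2 * \sum_i F i s / (2 * m%:R * r' i) <= vol s.
  have [m0|mpos] := posnP m.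
    rewrite big1 ?mulr0 => [|i _]; first exact: ltW.
    by move: (ltn_ord i); rewrite {2}m0.
  have mne : (m%:R : R) != 0 by rewrite pnatr_eq0 -lt0n.
  rewrite (eq_bigr (fun=> vol s / (2 * m%:R))) => [|i _].
    rewrite sumr_const card_ord -mulr_natr.
    rewrite [leLHS](_ : _ = vol s)//; first by field.
  have Fi : F i s = r' i * vol s by rewrite divfK// gt_eqF.
  rewrite {1}Fi; have := r'0 i; move: (r' i) => x x0; field.
  by rewrite mne gt_eqF.
have := nxP (avg_prod s) v' r' (ltW avg0).
rewrite v'0 lexx => /(_ isT) /(_ (or_intror (conj erefl r'0))) nx1.
(* The next stopping nodes use at most half of [vol s], so an amount [v' * vol s] of the budget
   [2 * ms] is left for the term [vol s * H s]. [H3] says that the error term on the right is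
   nonnegative at a stopping node. *)
have H1 : v' * (2 * \sum_i F i s / (2 * m%:R * r' i)) <= v' * vol s.
  by rewrite ler_wpM2l.
have H2 : H s * vol s <= v' * vol s by rewrite ler_wpM2r// ltW.
have H3 : v * vol s <= v * \sum_i F i s / (2 * m%:R * r i).
  case: vr => [->|[uE r0]]; first by rewrite !mul0r.
  by rewrite ler_wpM2l// avg_prod_jump// -uE.
move: nx1 H1 H2 H3; set S1 := \sum_i _; set S2 := \sum_i _ => *; lra.
Qed.

(** At least half of each stopping node lies outside the next stopping nodes below it. These parts
    are disjoint, and on them [H] of the node is below the running maximum; this gives the factor
    2. *)
Lemma sparse_sum_le_max (H : T -> R) k s : (forall s, 0 <= H s) ->
  sparse_sum (fun s => vol s * H s) k 0 s <= 2 * max_sum vol H k 0 s.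
Proof.
move=> H0.
(* Here [v] is the running maximum and [r] lists the averages at the last stopping ancestor. The
   case [v = 0] covers the start, where there is no such ancestor. *)
suff gen u v (r : 'I_m -> R) : 0 <= u -> 0 <= v ->
    v = 0 \/ (u = \prod_i r i /\ forall i, 0 < r i) ->
    sparse_sum (fun s => vol s * H s) k u s <=
    2 * max_sum vol H k v s - 2 * v * vol s +
    2 * v * \sum_i F i s / (2 * m%:R * r i).
  have := gen 0 0 (fun=> 0) (lexx 0) (lexx 0) (or_introl erefl).
  by rewrite mulr0 !mul0r addr0 subr0.
elim: k u v r s => [|k IH] u v r s u0 v0 vr.
  apply: (@sparse_sum_step H (fun=> 0) (Num.max v (H s) * vol s)) => //.
  move=> u1 v1 r1 u10 /andP[v10 v1v] vr1.
  have vv : v1 * vol s <= Num.max v (H s) * vol s by rewrite ler_wpM2r// ltW.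
  have : 0 <= v1 * \sum_i F i s / (2 * m%:R * r1 i).
    case: vr1 => [->|[_ r10]]; first by rewrite mul0r.
    rewrite mulr_ge0// sumr_ge0// => i _.
    by rewrite divr_ge0// mulr_ge0 ?(ltW (r10 _))// mulr_ge0.
  lra.
apply: (@sparse_sum_step H (fun w => \sum_c
    sparse_sum (fun s => vol s * H s) k w (ch c s))
  (\sum_c max_sum vol H k (Num.max v (H s)) (ch c s))) => //.
move=> u1 v1 r1 u10 /andP[v10 v1v] vr1.
apply: le_trans (ler_sum _ (fun c _ => IH u1 v1 r1 (ch c s) u10 v10 vr1)) _.
rewrite big_split/= big_split/= sumrN -!mulr_sumr -addvol.
rewrite lerD//; last first.
  rewrite ler_wpM2l ?mulr_ge0// exchange_big/=; apply: ler_sum => i _.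
  by rewrite -mulr_suml -addF.
rewrite lerD2r ler_wpM2l//; apply: ler_sum => c _; apply: le_max_sum => //.
by move=> x; exact: ltW.
Qed.

Lemma le_sparse_sum f g k u s : (forall s, f s <= g s) ->
  sparse_sum f k u s <= sparse_sum g k u s.
Proof.
move=> fg; elim: k u s => [|k IH] u s /=; case: ifP => // _.
- by rewrite lerD.
- by rewrite lerD// ler_sum.
- by rewrite ler_sum.
Qed.

Lemma sparse_sum_ge0 (h : T -> R) k u s : (forall s, 0 <= h s) ->
  0 <= sparse_sum h k u s.
Proof.
move=> h0; elim: k u s => [|k IH] u s /=; case: ifP => _ //.
- by rewrite addr0.
- by rewrite addr_ge0 ?sumr_ge0.
- exact: sumr_ge0.
Qed.

Lemma sparse_sum_lin (I : finType) (a : I -> R) (f : I -> T -> R) k u s :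
  sparse_sum (fun s => \sum_i a i * f i s) k u s =
  \sum_i a i * sparse_sum (f i) k u s.
Proof.
elim: k u s => [|k IH] u s /=; case: ifP => _.
- by under [RHS]eq_bigr do rewrite addr0; rewrite addr0.
- by rewrite big1// => i _; rewrite mulr0.
- under [RHS]eq_bigr do rewrite mulrDr mulr_sumr; rewrite big_split/=.
  by congr (_ + _); rewrite exchange_big/=; apply: eq_bigr => c _; exact: IH.
- under [RHS]eq_bigr do rewrite mulr_sumr.
  by rewrite exchange_big/=; apply: eq_bigr => c _; exact: IH.
Qed.

Definition carleson_sum_cst := 2 * \sum_i p / ps i * (carleson_cst (ps i)) `^ (ps i).

Variables (sg h X : 'I_m -> T -> R) (B : R) (Y : 'I_m -> R).
Hypothesis ps1 : forall i, 1 < ps i.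
Hypotheses (p0 : 0 < p) (pE : p^-1 = \sum_i (ps i)^-1).
Hypotheses (sg0 : forall i s, 0 < sg i s) (h0 : forall i s, 0 <= h i s).
Hypotheses (addsg : forall i, tree_additive (sg i)).
Hypotheses (addh : forall i, tree_additive (h i)).
Hypothesis addX : forall i, tree_additive (X i).
Hypothesis young_h : forall i s (w : R), 0 <= w ->
  4 * w * h i s <= 4 * sg i s + w ^+ 2 * vol s.
Hypothesis young_F : forall i s (y : R), 0 <= y ->
  carleson_cst (ps i) * y `^ (ps i - 1) * F i s <=
  carleson_cst (ps i) `^ ps i * X i s + y `^ ps i * sg i s.
Hypothesis M0 : forall s, 0 <= M s.
Hypothesis B0 : 0 <= B.
Hypothesis M_le : forall s,
  M s <= vol s * (B * \prod_i (vol s / sg i s * (h i s / vol s) `^ (2 / ps i))) `^ p.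

(** The factors [vol / sg i] in the bound for [M] turn the averages of [F i] with respect to [vol]
    into averages with respect to [sg i]. Each term is then at most [B ^ p * vol] times the product
    of the powers [p / ps i] of [H i], and these exponents add up to 1. *)
Lemma sparse_sum_bound k s : (forall i, 0 < Y i) -> (forall i, X i s <= Y i) ->
  sparse_sum (fun s => M s * avg_prod s `^ p) k 0 s <=
  carleson_sum_cst * B `^ p * \prod_i Y i `^ (p / ps i).
Proof.
move=> Y0 XY; have psi0 i : 0 < ps i by apply: lt_trans (ps1 i).
pose th i := p / ps i.
have th0 i : 0 < th i by rewrite divr_gt0.
have th1 : \sum_i th i = 1 by rewrite -mulr_sumr -pE divff// gt_eqF.
pose H i s := (h i s / vol s) ^+ 2 * (F i s / sg i s) `^ ps i.
have H0 i x : 0 <= H i x by rewrite mulr_ge0 ?powR_ge0// sqr_ge0.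
pose K := B `^ p * \prod_i Y i `^ th i.
have K0 : 0 <= K by rewrite mulr_ge0 ?powR_ge0// prodr_ge0// => i _; rewrite powR_ge0.
have term x : M x * avg_prod x `^ p <= \sum_i (K * (th i / Y i)) * (vol x * H i x).
  have volx := vol0 x; have [vx0 vxn] := (ltW volx, lt0r_neq0 volx).
  have c0 i : 0 <= h i x / vol x by rewrite divr_ge0.
  have f0 i : 0 <= F i x / sg i x by rewrite divr_ge0// ltW.
  have P0 : 0 <= \prod_i (vol x / sg i x * (h i x / vol x) `^ (2 / ps i)).
    by apply: prodr_ge0 => i _; rewrite mulr_ge0 ?powR_ge0// divr_ge0// ltW.
  apply: (le_trans (ler_wpM2r (powR_ge0 _ _) (M_le x))).
  rewrite -mulrA -powRM ?avg_prod_ge0 ?mulr_ge0// -mulrA -big_split/=.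
  rewrite (eq_bigr (fun i => H i x `^ (ps i)^-1)) => [|i _]; last first.
    have -> : H i x `^ (ps i)^-1 =
        (h i x / vol x) `^ (2 / ps i) * (F i x / sg i x).
      rewrite /H powRM ?sqr_ge0 ?powR_ge0//; congr (_ * _).
        by rewrite -powR_mulrn ?c0// -powRrM.
      by rewrite -powRrM divff ?gt_eqF// powRr1.
    have sgi := lt0r_neq0 (sg0 i x); field.
    by rewrite sgi vxn.
  have Hp0 : 0 <= \prod_i H i x `^ (ps i)^-1.
    by apply: prodr_ge0 => i _; exact: powR_ge0.
  rewrite (powRM _ B0 Hp0) powR_prod => [|i]; last exact: powR_ge0.
  (* The sparse sum of [vol * H i] will be at most a constant times [Y i]. After this normalization
     each summand of the AM-GM inequality contributes a constant, and the product of the powers of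
     [Y i] stays outside. *)
  rewrite (eq_bigr (fun i => Y i `^ th i * (H i x / Y i) `^ th i)) => [|i _]; last first.
    rewrite -powRrM -powRM ?divr_ge0 ?H0//; try exact: ltW.
    by rewrite (mulrC (Y i)) divfK ?gt_eqF// /th (mulrC p).
  rewrite big_split/= (mulrA (B `^ p)) -/K.
  have HY0 i : 0 <= H i x / Y i by rewrite divr_ge0// ltW.
  have := weighted_AMGM th0 th1 HY0.
  move=> /(ler_wpM2l K0)/(ler_wpM2l vx0)/le_trans; apply.
  rewrite mulr_sumr mulr_sumr le_eqVlt; apply/orP; left; apply/eqP.
  by apply: eq_bigr => i _; ring.
apply: le_trans (le_sparse_sum _ _ _ term) _.
rewrite sparse_sum_lin.
rewrite -mulrA -/K /carleson_sum_cst mulrAC mulr_sumr.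
apply: ler_sum => i _.
have H1 := sparse_sum_le_max k s (H0 i).
have H2 := le_max_sum_carleson (ps1 i) vol0 (sg0 i) (h0 i) (F0 i) addvol
  (addsg i) (addh i) (addF i) (addX i) (young_h i) (young_F i) k s.
rewrite -/(H i) in H2.
have KY : 0 <= K * (th i / Y i) by rewrite mulr_ge0// divr_ge0// ltW.
apply: le_trans (ler_wpM2l KY H1) _.
have bY : carleson_cst (ps i) `^ ps i * X i s <= carleson_cst (ps i) `^ ps i * Y i.
  by rewrite ler_wpM2l ?powR_ge0.
have H3 := ler_wpM2l (ler0n R 2) (ler_wpM2l KY (le_trans H2 bY)).
rewrite mulrCA; apply: le_trans H3 _.
rewrite le_eqVlt; apply/orP; left; apply/eqP; rewrite /th.
have [Yi pi] := (lt0r_neq0 (Y0 i), lt0r_neq0 (psi0 i)); field.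
by rewrite Yi pi.
Qed.

End sparse.
End tree.

(** * Lebesgue measure of boxes *)

Section lower_integral.
Local Open Scope ereal_scope.
Context d (T : measurableType d) (R : realType).
Variable mu : {measure set T -> \bar R}.

(* No measurability is needed: the library integral of a nonnegative function is
   a supremum over simple functions below it. *)
Lemma ge0_le_integral_nomeas (D : set T) (f g : T -> \bar R) :
  (forall x, D x -> 0 <= f x) -> (forall x, D x -> f x <= g x) ->
  \int[mu]_(x in D) f x <= \int[mu]_(x in D) g x.
Proof.
move=> f0 fg; have g0 x : D x -> 0 <= g x by move=> Dx; exact: le_trans (f0 x Dx) (fg x Dx).
rewrite !ge0_integralE//; apply: le_ereal_sup => _ [h hf <-].
exists h => // x; apply: le_trans (hf x) _; rewrite !patchE; case: ifPn => //.
by rewrite inE => /fg.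
Qed.

Lemma le_integral_nomeas (D : set T) (f g : T -> \bar R) :
  (forall x, D x -> f x <= g x) ->
  \int[mu]_(x in D) f x <= \int[mu]_(x in D) g x.
Proof.
move=> fg; rewrite integralE [leRHS]integralE; apply: leeB.
  apply: ge0_le_integral_nomeas => x Dx; first exact: funepos_ge0.
  by rewrite !funeposE ge_max !le_max fg// lexx orbT.
apply: ge0_le_integral_nomeas => x Dx; first exact: funeneg_ge0.
by rewrite !funenegE ge_max !le_max leeN2 fg// lexx orbT.
Qed.

Lemma integral_null_set (D : set T) (f : T -> \bar R) : measurable D ->
  mu D = 0 -> (forall x, D x -> 0 <= f x) -> \int[mu]_(x in D) f x = 0.
Proof.
move=> mD D0 f0; apply/eqP; rewrite eq_le integral_ge0// andbT.
rewrite -(mule0 +oo) -D0 -integral_cst//.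
by apply: ge0_le_integral_nomeas => // x _; rewrite leey.
Qed.

End lower_integral.

Section boxes.
Context {R : realType}.
Local Notation leb := (lebesgue_Rn R).

Lemma measurable_prod_set n (A : 'I_n -> set (measurableTypeR R)) : (forall i, measurable (A i)) ->
  measurable [set x : Rn R n | forall i, A i (tnth x i)].
Proof.
move=> mA; rewrite (_ : [set _ | _] =
    \bigcap_(i in [set: 'I_n]) (fun x : Rn R n => tnth x i) @^-1` A i).
  apply: fin_bigcap_measurable => // i _.
  by rewrite -[X in measurable X]setTI; apply: measurable_tnth => //; exact: mA.
by apply/seteqP; split => x /= xA i; [move=> _|]; exact: xA.
Qed.

Lemma lebesgue_Rn_prod n (A : 'I_n -> set (measurableTypeR R)) : (forall i, measurable (A i)) ->
  leb n [set x | forall i, A i (tnth x i)] = (\prod_i lebesgue_measure (A i))%E.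
Proof.
elim: n A => [|n IH] A mA /=.
  rewrite big_ord0 diracE mem_set//=; first by case.
rewrite big_ord_recl /cons_measure /pushforward.
pose A' i := A (lift ord0 i).
rewrite [X in (_ \x _)%E X](_ : _ =
    A ord0 `*` [set x | forall i, A' i (tnth x i)]).
  have mA' i : measurable (A' i) by exact: mA.
  rewrite product_measure1E//; last exact: measurable_prod_set.
  by rewrite IH.
apply/seteqP; split => [[x y] /= xy|[x y] /= [x0 yA] i].
  split=> [|i]; first by have := xy ord0; rewrite tnth0.
  by have := xy (lift ord0 i); rewrite tnthS.
case: (unliftP ord0 i) => [j ->|->]; last by rewrite tnth0.
by rewrite tnthS; exact: yA.
Qed.

(** Half-open, so that the children of a dyadic box partition it exactly; the closed cube differs
    from it by a null set. *)
Definition hbox n (a : 'I_n -> R) (l : R) : set (Rn R n) :=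
  [set x | forall i, a i <= tnth x i < a i + l].

Let hboxE n (a : 'I_n -> R) l :
  hbox a l = [set x | forall i, `[a i, (a i + l)[%classic (tnth x i)].
Proof. by apply/seteqP; split => x /= xa i; have := xa i; rewrite in_itv. Qed.

Let cubeE n (a : Rn R n) (l : R) :
  cube a l = [set x | forall i, `[tnth a i, (tnth a i + l)]%classic (tnth x i)].
Proof. by apply/seteqP; split => x /= xa i; have := xa i; rewrite in_itv. Qed.

Lemma measurable_hbox n (a : 'I_n -> R) l : measurable (hbox a l).
Proof. by rewrite hboxE; exact: (@measurable_prod_set n (fun i => `[a i, (a i + l)[%classic)). Qed.

Lemma measurable_cube n (a : Rn R n) (l : R) : measurable (cube a l).
Proof.
rewrite cubeE.
exact: (@measurable_prod_set n (fun i => `[tnth a i, (tnth a i + l)]%classic)).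
Qed.

Lemma lebesgue_hbox n (a : 'I_n -> R) l : 0 < l -> leb n (hbox a l) = (l ^+ n)%:E.
Proof.
move=> l0; rewrite hboxE (@lebesgue_Rn_prod n (fun i => `[a i, (a i + l)[%classic))//.
under eq_bigr do rewrite lebesgue_measure_itv/= lte_fin ltrDl l0 -EFinD addrAC subrr add0r.
by rewrite prodEFin prodr_const card_ord.
Qed.

Lemma lebesgue_cube n (a : Rn R n) (l : R) : 0 < l -> leb n (cube a l) = (l ^+ n)%:E.
Proof.
move=> l0; rewrite cubeE (@lebesgue_Rn_prod n (fun i => `[tnth a i, (tnth a i + l)]%classic))//.
under eq_bigr do rewrite lebesgue_measure_itv/= lte_fin ltrDl l0 -EFinD addrAC subrr add0r.
by rewrite prodEFin prodr_const card_ord.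
Qed.

Lemma hbox_sub_cube n (a : Rn R n) (l : R) : hbox (tnth a) l `<=` cube a l.
Proof. by move=> x xa i; have /andP[-> /ltW ->] := xa i. Qed.

Lemma cube_boundary_null n (a : Rn R n) (l : R) : 0 < l ->
  leb n (cube a l `\` hbox (tnth a) l) = 0%E.
Proof.
move=> l0; have [mh mc] := (@measurable_hbox n (tnth a) l, @measurable_cube n a l).
rewrite measureD//; last by rewrite [ltLHS]lebesgue_cube ?ltry.
rewrite setIidr; last exact: hbox_sub_cube.
by rewrite [X in (X - _)%E]lebesgue_cube// [X in (_ - X)%E]lebesgue_hbox// subee.
Qed.

Lemma integral_cube n (a : Rn R n) (l : R) (f : Rn R n -> \bar R) : 0 < l ->
  measurable_fun setT f -> (forall x, 0 <= f x)%E ->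
  (\int[leb n]_(x in cube a l) f x = \int[leb n]_(x in hbox (tnth a) l) f x)%E.
Proof.
move=> l0 mf f0.
have mD : measurable (cube a l `\` hbox (tnth a) l).
  by apply: measurableD; [exact: measurable_cube|exact: measurable_hbox].
rewrite (ge0_negligible_integral mD).
- by rewrite setDD setIidr//; exact: hbox_sub_cube.
- exact: measurable_cube.
- exact: measurable_funTS.
- by move=> x _; exact: f0.
- exact: cube_boundary_null.
Qed.

End boxes.

(** * Shifted dyadic grids *)

Section descendants.
Context {T : Type} {C : finType}.
Variable ch : C -> T -> T.

Fixpoint descendant (k : nat) (s s' : T) : Prop :=
  s' = s \/ if k is k'.+1 then exists c, descendant k' (ch c s) s' else False.

(** Pointwise domination, with [I] marking the nodes whose tent contains a given point. Up to
    [stop_ratio], the average at [s'] is bounded by the one at its last stopping ancestor. That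
    ancestor is marked too, since marks pass to parents, so its term occurs in the sum. The first
    alternative is the case in which no node from [s] to [s'] stops. *)
Lemma avg_prod_le_sparse (R : realType) m (p : R) (vol : T -> R)
    (F : 'I_m -> T -> R) (I : T -> bool) k (u : R) s s' :
  (forall s, 0 < vol s) -> (forall i s, 0 <= F i s) ->
  (forall c s, I (ch c s) -> I s) -> 0 <= p -> 0 <= u ->
  descendant k s s' -> I s' ->
  avg_prod vol F s' <= @stop_ratio R m * u \/
  avg_prod vol F s' `^ p <= @stop_ratio R m `^ p *
    sparse_sum ch vol F (fun s => (I s)%:R * avg_prod vol F s `^ p) k u s.
Proof.
move=> vol0 F0 Ich p0.
have avg0 x : 0 <= avg_prod vol F x by exact: avg_prod_ge0.
have a0 : 0 <= @stop_ratio R m by exact: stop_ratio_ge0.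
have Idesc j x y : descendant j x y -> I y -> I x.
  elim: j x => [|j IH] x /=; first by case=> // ->.
  by case=> [->//|[c xy] Iy]; apply: (Ich c); exact: IH xy Iy.
have ss0 j v x : 0 <= sparse_sum ch vol F
    (fun s => (I s)%:R * avg_prod vol F s `^ p) j v x.
  by apply: sparse_sum_ge0 => y; rewrite mulr_ge0 ?powR_ge0.
have a1 : 1 <= @stop_ratio R m.
  case: (posnP m) => [->|m0]; first by rewrite /stop_ratio expr0.
  by rewrite /stop_ratio exprn_ege1// -natrM ler1n muln_gt0.
have ap1 : 1 <= @stop_ratio R m `^ p.
  by have := le_powR_base p0 ler01 a1; rewrite powR1.
have le_ap x : 0 <= x -> x <= @stop_ratio R m `^ p * x by move=> ?; rewrite ler_peMl.
elim: k u s => [|k IH] u s u0.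
  case=> // -> Is; have [us|us] := ltP (@stop_ratio R m * u) (avg_prod vol F s).
    by right; rewrite /= us addr0 Is mul1r le_ap// powR_ge0.
  by left.
have stepc w c : 0 <= w -> descendant k (ch c s) s' -> I s' ->
    avg_prod vol F s' <= @stop_ratio R m * w \/
    avg_prod vol F s' `^ p <= @stop_ratio R m `^ p * \sum_c sparse_sum ch vol F
      (fun s => (I s)%:R * avg_prod vol F s `^ p) k w (ch c s).
  move=> w0 dc Is; have [le1|le1] := IH w (ch c s) w0 dc Is; first by left.
  right; apply: le_trans le1 _; rewrite ler_wpM2l ?powR_ge0//.
  by rewrite (bigD1 c)//= lerDl sumr_ge0.
case=> [->|[c cs']] Is; have [us|us] := ltP (@stop_ratio R m * u) (avg_prod vol F s).
- right; rewrite /= us Is mul1r; apply: le_trans (le_ap _ (powR_ge0 _ _)) _.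
  by rewrite ler_wpM2l ?powR_ge0// lerDl sumr_ge0.
- by left.
- right; rewrite /= us (Idesc k.+1 s s') ?mul1r//; last by right; exists c.
  rewrite mulrDr; have [le1|le1] := stepc _ c (avg0 s) cs' Is.
    apply: (@le_trans _ _ ((@stop_ratio R m * avg_prod vol F s) `^ p)).
      exact: le_powR_base.
    by rewrite powRM// lerDl mulr_ge0 ?powR_ge0// sumr_ge0.
  by apply: le_trans le1 _; rewrite lerDr mulr_ge0 ?powR_ge0.
- by rewrite /= ltNge us/=; exact: stepc cs' Is.
Qed.
End descendants.

Section dyadic.
Context {R : realType} {n : nat}.
Variables (rho : 'I_n -> R) (L : R).
Hypothesis L0 : 0 < L.

Definition dnode := (nat * ('I_n -> nat))%type.
Definition dside (s : dnode) : R := L / 2 ^+ s.1.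
Definition dbox (s : dnode) : set (Rn R n) :=
  hbox (fun i => rho i + (s.2 i)%:R * dside s) (dside s).
Definition dchild (c : {ffun 'I_n -> bool}) (s : dnode) : dnode :=
  (s.1.+1, fun i => (2 * s.2 i + c i)%N).
Definition droot : dnode := (0, fun=> 0)%N.

Lemma dside_gt0 s : 0 < dside s.
Proof. by rewrite divr_gt0// exprn_gt0. Qed.

Lemma dside_child c s : dside (dchild c s) = dside s / 2.
Proof. by rewrite /dside/= exprS; field; rewrite expf_neq0. Qed.

Lemma measurable_dbox s : measurable (dbox s).
Proof. exact: measurable_hbox. Qed.

Let in_half (r k d y : R) (c : bool) : 0 < d ->
  (r + (2 * k + c%:R) * (d / 2) <= y < r + (2 * k + c%:R) * (d / 2) + d / 2) <->
  (r + k * d <= y < r + k * d + d /\ c = (r + (k + 2^-1) * d <= y)).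
Proof.
move=> d0; split; case: c => /=.
- move=> /andP[y1 y2]; split; first by apply/andP; split; lra.
  by apply/esym; lra.
- move=> /andP[y1 y2]; split; first by apply/andP; split; lra.
  by apply/esym/negbTE; rewrite -ltNge; lra.
- by move=> [/andP[y1 y2] /esym y3]; apply/andP; split; lra.
- move=> [/andP[y1 y2] /esym/negbT]; rewrite -ltNge => y3.
  by apply/andP; split; lra.
Qed.

Let in_dchild c s (x : Rn R n) : dbox (dchild c s) x <->
  dbox s x /\ forall i, c i = (rho i + ((s.2 i)%:R + 2^-1) * dside s <= tnth x i).
Proof.
rewrite /dbox /hbox /= dside_child; have d0 := dside_gt0 s.
split=> [xc|[xs xc] i]; last first.
  by rewrite natrD natrM; apply/in_half.
by split=> i; have := xc i; rewrite natrD natrM => /in_half[].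
Qed.

Lemma dbox_child c s : dbox (dchild c s) `<=` dbox s.
Proof. by move=> x /in_dchild[]. Qed.

Lemma dbox_split s : dbox s =
  \big[setU/set0]_(c <- index_enum {ffun 'I_n -> bool}) dbox (dchild c s).
Proof.
apply/seteqP; split => [x sx|x].
  rewrite -bigcup_seq; exists [ffun i =>
    (rho i + ((s.2 i)%:R + 2^-1) * dside s <= tnth x i)].
    by rewrite /= mem_index_enum.
  by apply/in_dchild; split => // i; rewrite ffunE.
by rewrite -bigcup_seq => -[c _]; exact: dbox_child.
Qed.

Lemma trivIset_dchild s (D : set {ffun 'I_n -> bool}) :
  trivIset D (fun c => dbox (dchild c s)).
Proof.
move=> c1 c2 _ _ [x [/in_dchild[_ x1] /in_dchild[_ x2]]].
by apply/ffunP => i; rewrite x1 x2.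
Qed.

Lemma integral_dbox (mu : {measure set (Rn R n) -> \bar R}) (f : Rn R n -> \bar R) s :
  measurable_fun setT f -> (forall x, 0 <= f x)%E ->
  (\int[mu]_(x in dbox s) f x = \sum_c \int[mu]_(x in dbox (dchild c s)) f x)%E.
Proof.
move=> mf f0; rewrite {1}dbox_split ge0_integral_bigsetU//=.
- by move=> c; exact: measurable_dbox.
- exact: index_enum_uniq.
- exact: trivIset_dchild.
- exact: measurable_funTS.
Qed.

(** Going up one generation halves the indices, so the child through which the path to [K] leaves
    [s] is read off from the binary digits of [K]. *)
Lemma descendant_quotient k j (s : dnode) (K : 'I_n -> nat) : (j <= k)%N ->
  (forall i, K i %/ 2 ^ j = s.2 i)%N ->
  descendant dchild k s (s.1 + j, K)%N.
Proof.
elim: k j s => [|k IH] j s jk Ks.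
  move: jk Ks; rewrite leqn0 => /eqP -> Ks; left.
  rewrite addn0; case: s Ks => s1 s2 /= Ks; congr pair; apply/funext => i.
  by rewrite -Ks expn0 divn1.
case: j jk Ks => [|j] jk Ks.
  left; rewrite addn0; case: s Ks => s1 s2 /= Ks; congr pair; apply/funext => i.
  by rewrite -Ks expn0 divn1.
right; exists [ffun i => odd (K i %/ 2 ^ j)].
rewrite (_ : (s.1 + j.+1, K)%N = ((dchild [ffun i => odd (K i %/ 2 ^ j)] s).1 + j, K)%N);
  last by rewrite /= addSnnS.
apply: IH => // i /=; rewrite ffunE -Ks expnSr divnMA.
by rewrite divn2 mul2n addnC odd_double_half.
Qed.

Lemma descendant_droot k j (K : 'I_n -> nat) : (j <= k)%N ->
  (forall i, K i < 2 ^ j)%N -> descendant dchild k droot (j, K).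
Proof.
by move=> jk Kj; apply: (@descendant_quotient k j droot) => // i; rewrite divn_small.
Qed.

End dyadic.

(** * The one-third trick *)

Section one_third.
Context {R : realType}.

(** The two root intervals [[-L/3, 2L/3)] and [[-2L/3, L/3)] have [[-L/3, L/3)] in common, and their
    shifts differ by [L / 3]. *)
Definition third_shift (L : R) (b : bool) : R := if b then - L / 3 else - 2 * L / 3.

(* The endpoints of the two shifted dyadic grids of mesh [d] are at distance at
   least [d / 3], because 3 does not divide [2 ^ j]. *)
Lemma one_third_trick (L b l : R) (j : nat) (d := L / 2 ^+ j) :
  0 < l -> 3 * l < d -> - L / 3 <= b -> b + l < L / 3 ->
  exists (g : bool) (k : nat), [/\ (k < 2 ^ j)%N,
    third_shift L g + k%:R * d <= b &
    b + l < third_shift L g + k%:R * d + d].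
Proof.
move=> l0 ld Lb bL; have L0 : 0 < L by lra.
have j0 : 0 < (2 : R) ^+ j by rewrite exprn_gt0.
have d0 : 0 < d by rewrite divr_gt0.
have Ld : L = 2 ^+ j * d by rewrite /d mulrC divfK// gt_eqF.
pose k g := Num.truncn ((b - third_shift L g) / d).
have kP g : third_shift L g + (k g)%:R * d <= b < third_shift L g + (k g)%:R * d + d.
  have : 0 <= (b - third_shift L g) / d.
    by rewrite divr_ge0 ?(ltW d0)// /third_shift; case: g; lra.
  move=> /truncn_itv /andP[]; rewrite -/(k g) ler_pdivlMr// ltr_pdivrMr// -natr1.
  by move=> ? ?; apply/andP; split; lra.
have kj g : (k g < 2 ^ j)%N.
  rewrite -(ltr_nat R) natrX -(ltr_pM2r d0) -Ld.
  have /andP[+ _] := kP g; rewrite /third_shift; case: g; lra.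
have [k1|k1] := ltP (b + l) (third_shift L true + (k true)%:R * d + d).
  by exists true, (k true); split => //; have /andP[] := kP true.
have [k2|k2] := ltP (b + l) (third_shift L false + (k false)%:R * d + d).
  by exists false, (k false); split => //; have /andP[] := kP false.
exfalso; have /andP[_ b1] := kP true; have /andP[_ b2] := kP false.
move: k1 k2 b1 b2; rewrite /third_shift; move: (k true) (k false) => k1 k2 H1 H2 H3 H4.
(* Both grids have an endpoint in the interval from [b] to [b + l]. Measured in units of [d / 3]
   these endpoints differ by an integer of modulus less than 1, so they coincide. *)
have E1 : (2 ^ j + 3 * k1)%:R * d < (3 * k2 + 1)%:R * d.
  rewrite (natrD _ (2 ^ j)) (natrD _ _ 1) !natrM natrX (mulrDl (2 ^+ j)) -Ld; lra.
have E2 : (3 * k2)%:R * d < (2 ^ j + 3 * k1 + 1)%:R * d.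
  rewrite (natrD _ _ 1) (natrD _ (2 ^ j)) !natrM natrX !(mulrDl _ _ d) -Ld; lra.
move: E1 E2; rewrite !(ltr_pM2r d0) !ltr_nat !addn1 !ltnS => E1 E2.
have /eqP E : (2 ^ j + 3 * k1 == 3 * k2)%N by rewrite eqn_leq E1 E2.
have : (3 %| 2 ^ j)%N.
  by rewrite -(dvdn_addl (2 ^ j) (dvdn_mulr k1 (dvdnn 3))) E dvdn_mulr.
by rewrite Euclid_dvdX//= andbC; case: j {E E1 E2 d ld j0 d0 Ld kP kj k H1 H2 H3 H4}.
Qed.

Lemma dyadic_scale (L l : R) (N : nat) : 0 < l -> 3 * l < L -> L / 2 ^+ N <= 3 * l ->
  exists2 j, (j <= N)%N & 3 * l < L / 2 ^+ j <= 6 * l.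
Proof.
move=> l0 lL; elim: N => [|N IH]; first by rewrite expr0 divr1 leNgt lL.
have [H _|H LN] := leP (L / 2 ^+ N) (3 * l).
  by have [j jN ?] := IH H; exists j => //; exact: leqW.
exists N; rewrite ?leqnSn// H/=.
move: LN; rewrite exprS invfM mulrCA mulrA; lra.
Qed.

(** Every coordinate selects its own shift, hence the index set of size [2 ^ n] for the grids. The
    generation is the last one whose mesh exceeds [3 * l], as the one-third trick demands, so the
    mesh is at most [6 * l]. *)
Lemma dyadic_cover n (a : Rn R n) (L l : R) (N : nat) : 0 < l -> 3 * l < L ->
  (forall i, - L / 3 <= tnth a i /\ tnth a i + l < L / 3) -> L / 2 ^+ N <= 3 * l ->
  exists (g : {ffun 'I_n -> bool}) (s : dnode), [/\ descendant (@dchild n) N droot s,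
    cube a l `<=` dbox (fun i => third_shift L (g i)) L s &
    l < dside L s <= 6 * l].
Proof.
move=> l0 lL aL LN; have [j jN /andP[j1 j2]] := dyadic_scale l0 lL LN.
have H i := one_third_trick l0 j1 (proj1 (aL i)) (proj2 (aL i)).
pose g i := projT1 (cid (H i)).
pose K i := projT1 (cid (projT2 (cid (H i)))).
have HK i : [/\ (K i < 2 ^ j)%N,
    third_shift L (g i) + (K i)%:R * (L / 2 ^+ j) <= tnth a i &
    tnth a i + l < third_shift L (g i) + (K i)%:R * (L / 2 ^+ j) + L / 2 ^+ j].
  exact: (projT2 (cid (projT2 (cid (H i))))).
exists [ffun i => g i], (j, K); split.
- by apply: descendant_droot => // i; have [] := HK i.
- move=> x xa i; rewrite ffunE /=; have [_ h1 h2] := HK i.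
  have /andP[x1 x2] := xa i; rewrite /dside/=.
  by rewrite (le_trans h1 x1) (le_lt_trans x2 h2).
- rewrite /dside/= j2 andbT; lra.
Qed.

End one_third.

(** * Integrals over dyadic boxes *)

Section ae_linear.
Context d (T : measurableType d) (R : realType).
Variable mu : {measure set T -> \bar R}.
Local Open Scope ereal_scope.

(** Transfers the pointwise Young inequalities to the node integrals, in the form assumed by the
    tree argument. *)
Lemma ae_le_integral_lin (D : set T) (f1 f2 f3 : T -> R) (c1 c2 c3 : R) :
  measurable D -> measurable_fun setT f1 -> measurable_fun setT f2 ->
  measurable_fun setT f3 -> (forall x, 0 <= f1 x)%R -> (forall x, 0 <= f2 x)%R ->
  (forall x, 0 <= f3 x)%R -> (0 <= c1)%R -> (0 <= c2)%R -> (0 <= c3)%R ->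
  {ae mu, forall x, (c1 * f1 x <= c2 * f2 x + c3 * f3 x)%R} ->
  c1%:E * \int[mu]_(x in D) (f1 x)%:E <=
  c2%:E * \int[mu]_(x in D) (f2 x)%:E + c3%:E * \int[mu]_(x in D) (f3 x)%:E.
Proof.
move=> mD mf1 mf2 mf3 f10 f20 f30 c10 c20 c30 le123.
have mE (f : T -> R) : measurable_fun setT f -> measurable_fun D (EFin \o f).
  by move=> mf; apply/measurable_EFinP; exact: measurable_funTS.
have mZ (c : R) (f : T -> R) : measurable_fun setT f ->
    measurable_fun D (fun x => c%:E * (f x)%:E).
  by move=> mf; apply: emeasurable_funM => //; exact: mE.
rewrite -!ge0_integralZl//; try exact: mE; try by move=> x _; rewrite lee_fin.
rewrite -ge0_integralD//; try exact: mZ;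
  try by move=> x _; rewrite -EFinM lee_fin mulr_ge0.
apply: ae_ge0_le_integral => //; try exact: mZ.
- by move=> x _; rewrite -EFinM lee_fin mulr_ge0.
- by move=> x _; rewrite -!EFinM lee_fin addr_ge0// mulr_ge0.
- by apply: emeasurable_funD; exact: mZ.
- by apply: filterS le123 => x le1 _; rewrite -!EFinM -EFinD lee_fin.
Qed.

End ae_linear.

Section node_integrals.
Context {R : realType} {n : nat}.
Local Notation leb := (lebesgue_Rn R n).
Variables (rho : 'I_n -> R) (L : R).
Hypothesis L0 : 0 < L.

Definition box_integrable (f : Rn R n -> R) :=
  forall a (l : R), 0 < l -> (\int[leb]_(x in hbox a l) (f x)%:E < +oo)%E.

Definition dint (f : Rn R n -> R) s : R :=
  fine (\int[leb]_(x in dbox rho L s) (f x)%:E)%E.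

Definition dvol (s : @dnode n) : R := (dside L s) ^+ n.

Lemma dvol_gt0 s : 0 < dvol s.
Proof. by rewrite exprn_gt0// dside_gt0. Qed.

Lemma lebesgue_dbox s : leb (dbox rho L s) = (dvol s)%:E.
Proof. by rewrite lebesgue_hbox// dside_gt0. Qed.

Lemma dvolE s : dvol s = dint (cst 1) s.
Proof.
rewrite /dint (_ : (fun x => _) = cst 1%E)// integral_cst; last exact: measurable_dbox.
by rewrite mul1e [X in fine X]lebesgue_dbox.
Qed.

Section one_function.
Variable f : Rn R n -> R.
Hypotheses (mf : measurable_fun setT f) (f0 : forall x, 0 <= f x).
Hypothesis fi : box_integrable f.

Lemma dint_ge0 s : 0 <= dint f s.
Proof. by rewrite fine_ge0// integral_ge0// => x _; rewrite lee_fin. Qed.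

Lemma dintK s : ((dint f s)%:E = \int[leb]_(x in dbox rho L s) (f x)%:E)%E.
Proof.
rewrite fineK// ge0_fin_numE; first by apply: fi; exact: dside_gt0.
by apply: integral_ge0 => x _; rewrite lee_fin.
Qed.

Lemma dint_additive : tree_additive (@dchild n) (dint f).
Proof.
move=> s; apply: EFin_inj; rewrite dintK integral_dbox //.
by rewrite -sumEFin; apply: eq_bigr => c _; rewrite dintK.
exact/measurable_EFinP.
Qed.

Lemma dint_gt0 s : {ae leb, forall x, 0 < f x} -> 0 < dint f s.
Proof.
move=> fpos; rewrite lt_neqAle dint_ge0 andbT; apply/eqP => /esym f_0.
have [N [mN N0 subN]] : ae_eq leb (dbox rho L s) (EFin \o f) (cst 0%E).
  apply/(ae_eq_integral_abs _ _).
  - exact: measurable_dbox.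
  - by apply/measurable_EFinP; exact: measurable_funTS.
  - under eq_integral do rewrite /= ger0_norm//.
    by rewrite -dintK f_0.
have [N' [mN' N'0 subN']] := fpos.
have : (leb (dbox rho L s) <= leb (N `|` N'))%E.
  apply: le_measure; rewrite ?inE; [exact: measurable_dbox|exact: measurableU|].
  move=> x sx; have [fx|fx] := ltP 0 (f x); [left|right].
    by apply: subN => /= /(_ sx)[fx0]; rewrite fx0 ltxx in fx.
  by apply: subN' => /=; apply/negP; rewrite -leNgt.
rewrite lebesgue_dbox leNgt measureU0// N0 lte_fin dvol_gt0.
by [].
Qed.

End one_function.
End node_integrals.

(** * Dual weights *)

Section dual_weight.
Context {R : realType} {n : nat}.
Local Notation leb := (lebesgue_Rn R n).
Variables (q : R) (w : Rn R n -> R).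
Hypotheses (q1 : 1 < q) (mw : measurable_fun setT w) (w0 : forall x, 0 <= w x).

(* The dual weight with the value [0] instead of [+oo] where [w] vanishes. *)
Definition rdual_weight (x : Rn R n) : R := w x `^ (- (q - 1)^-1).

Let q10 : 0 < q - 1. Proof. by rewrite subr_gt0. Qed.

Lemma dual_weightE x : dual_weight q w x =
  if w x == 0 then +oo%E else (rdual_weight x)%:E.
Proof.
have q1n : q - 1 != 0 by rewrite gt_eqF.
have E : 1 - conj_exponent q = - (q - 1)^-1 by rewrite /conj_exponent; field.
rewrite /dual_weight /epow E oppr_lt0 invr_gt0 q10 opprK poweR_EFin.
rewrite /inve powR_eq0 invr_eq0 (negbTE q1n) andbT.
by case: ifP => // _; rewrite /rdual_weight powRN.
Qed.

Lemma rdual_weight_ge0 x : 0 <= rdual_weight x.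
Proof. exact: powR_ge0. Qed.

Lemma rdual_weight0 x : w x = 0 -> rdual_weight x = 0.
Proof. by move=> wx; rewrite /rdual_weight wx powR0// oppr_eq0 invr_eq0 gt_eqF. Qed.

Lemma measurable_rdual_weight : measurable_fun setT rdual_weight.
Proof. exact: (measurableT_comp (measurable_powR _)). Qed.

Lemma measurable_dual_weight : measurable_fun setT (dual_weight q w).
Proof.
rewrite (_ : dual_weight q w =
    fun x => if w x == 0 then +oo%E else (rdual_weight x)%:E); last first.
  by apply/funext => x; exact: dual_weightE.
apply: measurable_fun_ifT => //.
  exact: (measurable_fun_eqr mw (measurable_cst _)).
apply/measurable_EFinP; exact: measurable_rdual_weight.
Qed.

Lemma dual_weight_gt0 x : (0 < dual_weight q w x)%E.
Proof.
rewrite dual_weightE; case: eqP => [//|/eqP wx].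
by rewrite lte_fin powR_gt0// lt_neqAle eq_sym wx w0.
Qed.

Lemma le_rdual_weight x : ((rdual_weight x)%:E <= dual_weight q w x)%E.
Proof. by rewrite dual_weightE; case: ifP => _; rewrite ?leey. Qed.

Lemma rdual_weightM x : 0 < w x -> rdual_weight x `^ q * w x = rdual_weight x.
Proof.
move=> wx; rewrite /rdual_weight -powRrM -[X in _ * X]powRr1 ?w0//.
rewrite -powRD; last by rewrite (gt_eqF wx) implybT.
by congr (_ `^ _); have := lt0r_neq0 q10; move=> ?; field.
Qed.

Lemma rdual_weight_gt0 x : 0 < w x -> 0 < rdual_weight x.
Proof. exact: powR_gt0. Qed.

End dual_weight.

Section dual_weight_positive.
Context {R : realType} {n : nat}.
Local Notation leb := (lebesgue_Rn R n).
Variables (q : R) (w : Rn R n -> R).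
Hypotheses (q1 : 1 < q) (mw : measurable_fun setT w) (w0 : forall x, 0 <= w x).
Hypothesis fin_dual : forall a l, 0 < l ->
  (\int[leb]_(x in cube a l) dual_weight q w x < +oo)%E.

(** The dual weight is [+oo] on the zero set of [w], so its finite integrals over cubes exhausting
    the space force that set to be null. *)
Lemma weight_ae_gt0 : {ae leb, forall x, 0 < w x}.
Proof.
pose N := w @^-1` [set 0].
have mN : measurable N by rewrite -[X in measurable X]setTI; exact: mw.
(* The [+ 1] keeps the side positive for [k = 0]. *)
pose Q k : set (Rn R n) := cube [tuple (- k%:R : R) | i < n] (2 * k%:R + 1).
have mQ k : measurable (Q k) by exact: measurable_cube.
have N0 : leb N = 0%E; last first.
  exists N; split => // x /= /negP; rewrite -leNgt => wx.
  by apply/eqP; rewrite eq_le wx w0.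
have NQ : N = \bigcup_k (N `&` Q k).
  rewrite -setI_bigcupr (_ : \bigcup_k Q k = setT) ?setIT//.
  apply/seteqP; split => // x _.
  pose K := (\sum_i (Num.truncn `|tnth x i|).+1)%N.
  exists K => // i; rewrite tnth_mktuple.
  have : `|tnth x i| <= K%:R.
    apply: ltW; apply: lt_le_trans (truncnS_gt _) _.
    by rewrite ler_nat /K (bigD1 i)//= leq_addr.
  by rewrite ler_norml => /andP[? ?]; apply/andP; split => //; lra.
apply: measure_negligible => //; rewrite NQ.
apply: negligible_bigcup => k; apply/negligibleP; first exact: measurableI.
apply/eqP; apply: contraT => NQ0.
have : (+oo <= \int[leb]_(x in Q k) dual_weight q w x)%E; last first.
  by rewrite leye_eq => /eqP inf; have := @fin_dual [tuple (- k%:R : R) | i < n]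
    (2 * k%:R + 1); rewrite -/(Q k) inf => /(_ _)/negP; rewrite ltxx => -[]//.
have mNQ : measurable (N `&` Q k) by exact: measurableI.
have <- : (\int[leb]_(x in N `&` Q k) cst +oo x = +oo)%E.
  by rewrite integral_cst// gt0_mulye// lt_neqAle eq_sym NQ0 measure_ge0.
apply: (@le_trans _ _ (\int[leb]_(x in N `&` Q k) dual_weight q w x)%E).
  apply: le_integral_nomeas => x [/= wx _].
  by rewrite dual_weightE// wx eqxx.
apply: ge0_subset_integral => //.
- by apply: measurable_funTS; exact: measurable_dual_weight.
- by move=> x _; apply/ltW/dual_weight_gt0.
Qed.

End dual_weight_positive.

Lemma le_ln_affine (R : realType) (x c : R) : 0 < x -> 0 < c -> ln x <= x / c - 1 + ln c.
Proof.
move=> x0 c0; have xc : 0 < x / c by rewrite divr_gt0.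
rewrite -{1}(divfK (lt0r_neq0 c0) x) lnM ?posrE// lerD2r.
by rewrite -{1}(subrKC 1 (x / c)) le_ln1Dx//; lra.
Qed.

(** * A lower bound for the exponential in the B'_p condition *)

Section jensen.
Context {R : realType} {n m : nat}.
Local Notation leb := (lebesgue_Rn R n).
Variables (ps : 'I_m -> R) (w : 'I_m -> Rn R n -> R).
Hypotheses (ps1 : forall i, 1 < ps i).
Hypotheses (mw : forall i, measurable_fun setT (w i)) (w0 : forall i x, 0 <= w i x).

Definition sqrt_dual i x : R := rdual_weight (ps i) (w i) x `^ 2^-1.

Lemma measurable_sqrt_dual i : measurable_fun setT (sqrt_dual i).
Proof.
apply: (measurableT_comp (measurable_powR _)).
exact: measurable_rdual_weight.
Qed.

Variables (a : Rn R n) (l : R) (c : 'I_m -> R).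
Hypotheses (l0 : 0 < l) (c0 : forall i, 0 < c i).
Hypothesis w_pos : forall i, {ae leb, forall x, 0 < w i x}.
Hypothesis cE : forall i,
  (\int[leb]_(x in cube a l) (sqrt_dual i x)%:E = (l ^+ n * c i)%:E)%E.

Let k0 : R := \sum_i 2 / ps i * (1 - ln (c i)).
Let g x : \bar R :=
  (\sum_i (2 / ps i / c i)%:E * (dual_weight (ps i) (w i) x `^ 2^-1))%E.
Let psi x : \bar R :=
  lne (\prod_(i < m) epow (dual_weight (ps i) (w i) x) (- (ps i)^-1))%E.

Let ps0 i : 0 < ps i. Proof. exact: lt_trans (ps1 i). Qed.
Let k_gt0 i : 0 < 2 / ps i / c i. Proof. by rewrite !divr_gt0. Qed.

Let ge_affine x : (k0%:E - g x <= psi x)%E.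
Proof.
have [/forallP wx|] := boolP [forall i, 0 < w i x]; last first.
  rewrite negb_forall => /existsP[i]; rewrite lt_neqAle w0 andbT negbK eq_sym => wi.
  suff -> : g x = +oo%E by rewrite leNye.
  apply/eqP; rewrite /g esum_eqy => [|j _].
    apply/existsP; exists i; rewrite andTb dual_weightE// wi poweRyr ?invr_eq0//.
    by rewrite mulry gtr0_sg// mul1e.
  apply/eqP => gj; have : (0 <= (2 / ps j / c j)%:E *
      (dual_weight (ps j) (w j) x `^ 2^-1))%E.
    by rewrite mule_ge0 ?poweR_ge0// lee_fin ltW.
  by rewrite gj.
pose S i := rdual_weight (ps i) (w i) x.
have S0 i : 0 < S i by exact: rdual_weight_gt0.
have dE i : dual_weight (ps i) (w i) x = (S i)%:E.
  by rewrite dual_weightE// gt_eqF.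
have -> : g x = (\sum_i 2 / ps i / c i * S i `^ 2^-1)%:E.
  by rewrite -sumEFin; apply: eq_bigr => i _; rewrite dE.
have P0 : 0 < \prod_i (S i `^ (ps i)^-1)^-1.
  by apply: prodr_gt0 => i _; rewrite invr_gt0 powR_gt0.
have -> : psi x = (ln (\prod_i (S i `^ (ps i)^-1)^-1))%:E.
  rewrite /psi -lne_EFin// -prodEFin; congr lne; apply: eq_bigr => i _.
  rewrite dE /epow oppr_lt0 invr_gt0 ps0 opprK poweR_EFin.
  by rewrite /inve gt_eqF// powR_gt0.
rewrite -EFinB lee_fin -ler_expR lnK ?posrE// /k0 -sumrB expR_sum.
apply: ler_prod => i _; rewrite expR_ge0/= /powR gt_eqF// -expRN ler_expR.
(* The logarithm of [S i] is twice that of its square root, hence the coefficient [2 / ps i] of the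
   tangents. *)
have H := @le_ln_affine _ (S i `^ 2^-1) (c i) (powR_gt0 _ (S0 i)) (c0 i).
rewrite ln_powR in H; have ips : 0 <= (ps i)^-1 by rewrite invr_ge0 ltW.
have := ler_wpM2l ips H; rewrite /powR gt_eqF//.
set e := expR _; set u := ln (S i); set v := ln (c i); set z := (ps i)^-1.
have -> : 2 * z / c i * e = 2 * (z * (e / c i)) by rewrite -!mulrA (mulrC _ e).
rewrite !mulrDr mulrN; lra.
Qed.

Let measurable_sqrtd i :
  measurable_fun setT (fun x => dual_weight (ps i) (w i) x `^ 2^-1)%E.
Proof.
apply: (measurableT_comp (measurable_poweR _)).
exact: measurable_dual_weight.
Qed.

Let int_g : (\int[leb]_(x in cube a l) g x = (\sum_i 2 / ps i * l ^+ n)%:E)%E.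
Proof.
have mQ : measurable (cube a l) by exact: measurable_cube.
rewrite /g ge0_integral_sum//; last 2 first.
- move=> i; apply: emeasurable_funM => //; apply: measurable_funTS.
  exact: measurable_sqrtd.
- by move=> i x _; rewrite mule_ge0 ?poweR_ge0// lee_fin ltW.
rewrite -sumEFin; apply: eq_bigr => i _.
rewrite ge0_integralZl//; last 3 first.
- by apply: measurable_funTS; exact: measurable_sqrtd.
- by move=> x _; exact: poweR_ge0.
- by rewrite lee_fin ltW.
rewrite (_ : integral _ _ _ = (l ^+ n * c i)%:E); last first.
  rewrite -cE; apply: ae_eq_integral => //.
  - by apply: measurable_funTS; exact: measurable_sqrtd.
  - by apply/measurable_EFinP/measurable_funTS; exact: measurable_sqrt_dual.
  - apply: filterS (w_pos i) => x wx _.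
    by rewrite dual_weightE// gt_eqF.
rewrite -EFinM; congr EFin; have ci := lt0r_neq0 (c0 i).
have pi := lt0r_neq0 (ps0 i); field.
by rewrite ci pi.
Qed.

(* Jensen's inequality, from the tangents [ln x <= x / c i - 1 + ln (c i)] at the
   averages [c i]. The function [k0%:E - g x] below [psi] takes the value [-oo]
   where some weight vanishes, so that no integrability of [psi] is needed. *)
Lemma expeR_avg_ge : ((\prod_i (c i `^ (2 / ps i))^-1)%:E <=
  expeR (avg psi a l))%E.
Proof.
have mQ : measurable (cube a l) by exact: measurable_cube.
have Qfin : (leb (cube a l) < +oo)%E by rewrite [ltLHS]lebesgue_cube// ltry.
have ln0 : 0 < l ^+ n by exact: exprn_gt0.
have low : (((\sum_i - (2 / ps i) * ln (c i)) * l ^+ n)%:E <=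
    \int[leb]_(x in cube a l) psi x)%E.
  apply: (@le_trans _ _ (\int[leb]_(x in cube a l) (k0%:E - g x))%E); last first.
    by apply: le_integral_nomeas => x _; exact: ge_affine.
  rewrite (@integralB _ _ _ _ _ mQ (cst k0%:E) g).
  - rewrite int_g integral_cst// [X in (_ * X - _)%E]lebesgue_cube// -EFinM -EFinB.
    rewrite lee_fin /k0 -mulr_suml -mulrBl ler_wpM2r ?(ltW ln0)// -sumrB.
    by apply: ler_sum => i _; lra.
  - apply/integrableP; split => //; rewrite integral_cst//=.
    by rewrite lte_mul_pinfty// lee_fin.
  - apply/integrableP; split.
      apply: emeasurable_sum => i; apply: emeasurable_funM => //.
      by apply: measurable_funTS; exact: measurable_sqrtd.
    rewrite (eq_integral g) ?int_g ?ltry// => x _; rewrite gee0_abs//.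
    by apply: sume_ge0 => i _; rewrite mule_ge0 ?poweR_ge0// lee_fin ltW.
rewrite -[leLHS](_ : expeR (\sum_i - (2 / ps i) * ln (c i))%:E = _).
  rewrite lee_expeR /avg [X in inve X]lebesgue_cube// inver gt_eqF//.
  by rewrite lee_pdivlMr// -EFinM.
rewrite /= expR_sum; congr EFin; apply: eq_bigr => i _.
by rewrite /powR gt_eqF// -expRN mulNr.
Qed.

End jensen.

(** * Measure of tents *)

Section tents.
Context {R : realType} {n : nat}.

Lemma measurable_tent (A : set (Rn R n)) (l : R) : measurable A ->
  measurable [set z : Rn R n * measurableTypeR R | A z.1 /\ (0 <= z.2 < l)%R].
Proof.
move=> mA; rewrite (_ : [set _ | _] = A `*` `[0, l[%classic).
  by apply: measurableX => //; exact: measurable_itv.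
by apply/seteqP; split => -[x t] /= [Ax tl]; split => //; move: tl; rewrite in_itv.
Qed.

Lemma measurable_half_space : measurable (@half_space R n).
Proof.
rewrite (_ : half_space = [set: Rn R n] `*` `[0, +oo[%classic).
  by apply: measurableX => //; exact: measurable_itv.
apply/seteqP; split => -[x t] /=; rewrite /half_space /= in_itv/= andbT.
  by [].
by case.
Qed.

Lemma measurable_cube_tent (a : Rn R n) (l : R) : measurable (cube_tent a l).
Proof. by apply: measurable_tent; exact: measurable_cube. Qed.

Definition dtent (rho : 'I_n -> R) L s : set (Rn R n * measurableTypeR R) :=
  [set z | dbox rho L s z.1 /\ (0 <= z.2 < dside L s)%R].

Lemma measurable_dtent rho L s : measurable (dtent rho L s).
Proof. by apply: measurable_tent; exact: measurable_dbox. Qed.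

End tents.

Lemma avg_ge0 (R : realType) n (f : Rn R n -> \bar R) a l : 0 < l ->
  (forall x, 0 <= f x)%E -> (0 <= avg f a l)%E.
Proof.
move=> l0 f0; rewrite /avg [X in inve X]lebesgue_cube// inver gt_eqF ?exprn_gt0//.
rewrite mule_ge0 ?lee_fin ?invr_ge0 ?exprn_ge0 ?(ltW l0)//.
exact: integral_ge0.
Qed.

Lemma dual_weight_ge0 (R : realType) n (q : R) (w : Rn R n -> R) x :
  (0 <= dual_weight q w x)%E.
Proof. by rewrite /dual_weight /epow; case: ifP => _; rewrite ?inve_ge0 poweR_ge0. Qed.

Lemma B'_const_ge0 (R : realType) n m (ps : 'I_m -> R) (p : R)
    (mu : {measure set (Rn R n * measurableTypeR R)%type -> \bar R})
    (w : 'I_m -> Rn R n -> R) : (0 <= B'_const ps p mu w)%E.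
Proof.
rewrite /B'_const; apply: (le_trans _ (ereal_sup_ubound _)); last first.
  by exists [tuple (0 : R) | i < n], 1; split; [exact: ltr01|reflexivity].
rewrite mule_ge0 ?poweR_ge0// /mule_oo; case: ifP => // _.
rewrite mule_ge0 ?expeR_ge0// prode_ge0// => i _.
by apply: avg_ge0 => // x; exact: dual_weight_ge0.
Qed.

Section tent_bound.
Context {R : realType} {n m : nat}.
Local Notation leb := (lebesgue_Rn R n).
Variables (ps : 'I_m -> R) (p : R) (w : 'I_m -> Rn R n -> R).
Variable mu : {measure set (Rn R n * measurableTypeR R)%type -> \bar R}.
Hypotheses (ps1 : forall i, 1 < ps i) (p0 : 0 < p).
Hypotheses (mw : forall i, measurable_fun setT (w i)) (w0 : forall i x, 0 <= w i x).
Hypothesis B'_fin : B'_condition ps p mu w.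
Hypothesis fin_dual : forall i a (l : R), 0 < l ->
  (\int[leb]_(x in cube a l) dual_weight (ps i) (w i) x < +oo)%E.

Local Notation S i := (rdual_weight (ps i) (w i)).

Lemma weights_ae_gt0 i : {ae leb, forall x, 0 < w i x}.
Proof. by apply: (weight_ae_gt0 (ps1 i)) => // a l l0; exact: fin_dual. Qed.

Lemma box_integrable_dual i : box_integrable (S i).
Proof.
move=> a l l0; apply: le_lt_trans (fin_dual i [tuple a i | i < n] l0).
apply: (@le_trans _ _ (\int[leb]_(x in hbox a l) dual_weight (ps i) (w i) x)%E).
  by apply: le_integral_nomeas => x _; exact: le_rdual_weight.
apply: ge0_subset_integral.
- exact: measurable_hbox.
- exact: measurable_cube.
- by apply: measurable_funTS; exact: measurable_dual_weight.
- by move=> x _; apply/ltW/dual_weight_gt0.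
- rewrite {1}(_ : a = tnth [tuple a i | i < n]); first exact: hbox_sub_cube.
  by apply/funext => j; rewrite tnth_mktuple.
Qed.

Lemma sqr_sqrt_dual i x : sqrt_dual ps w i x ^+ 2 = S i x.
Proof.
by rewrite -powR_mulrn ?powR_ge0// -powRrM mulVf ?pnatr_eq0// powRr1// powR_ge0.
Qed.

(** A square root is at most its radicand plus 1. *)
Lemma box_integrable_sqrt_dual i : box_integrable (sqrt_dual ps w i).
Proof.
move=> a l l0.
have := @ae_le_integral_lin _ _ _ leb (hbox a l) (sqrt_dual ps w i) (S i) (cst 1) 1 1 1
  (measurable_hbox _ _) (measurable_sqrt_dual ps mw i) (measurable_rdual_weight (ps i) (mw i))
  (measurable_cst _) (fun=> powR_ge0 _ _) (rdual_weight_ge0 _ _) (fun=> ler01)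
  ler01 ler01 ler01.
rewrite !mul1e => H; apply: le_lt_trans (H _) _.
  apply: aeW => x; rewrite !mul1r /= -sqr_sqrt_dual.
  by have := sqr_ge0 (sqrt_dual ps w i x - 2^-1); rewrite sqrrB; lra.
apply: lte_add_pinfty; first exact: box_integrable_dual.
rewrite (_ : (fun x => _) = cst 1%E)// integral_cst; last exact: measurable_hbox.
by rewrite mul1e [ltLHS]lebesgue_hbox// ltry.
Qed.

Variables (rho : 'I_n -> R) (L : R) (s : @dnode n).
Hypothesis L0 : 0 < L.

Let l := dside L s.
Let a : Rn R n := [tuple rho i + (s.2 i)%:R * l | i < n].

Let dboxE : dbox rho L s = hbox (tnth a) l.
Proof. by rewrite /dbox; congr hbox; apply/funext => i; rewrite tnth_mktuple. Qed.

Let l0 : 0 < l. Proof. exact: dside_gt0. Qed.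

Let c i := dint rho L (sqrt_dual ps w i) s / dvol L s.

Let v0 : 0 < dvol L s. Proof. exact: dvol_gt0. Qed.

Lemma dint_dual_gt0 i : 0 < dint rho L (S i) s.
Proof.
apply: dint_gt0 => //.
- exact: measurable_rdual_weight.
- exact: rdual_weight_ge0.
- exact: box_integrable_dual.
- by apply: filterS (weights_ae_gt0 i) => x; exact: rdual_weight_gt0.
Qed.

Let c0 i : 0 < c i.
Proof.
apply: divr_gt0 => //; apply: dint_gt0 => //.
- exact: measurable_sqrt_dual.
- by move=> x; exact: powR_ge0.
- exact: box_integrable_sqrt_dual.
- apply: filterS (weights_ae_gt0 i) => x wx.
  by apply: powR_gt0; exact: rdual_weight_gt0.
Qed.

Let cE i : (\int[leb]_(x in cube a l) (sqrt_dual ps w i x)%:E = (l ^+ n * c i)%:E)%E.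
Proof.
rewrite integral_cube//.
- rewrite /c mulrC divfK ?gt_eqF// dintK ?dboxE//; first by move=> x; exact: powR_ge0.
  exact: box_integrable_sqrt_dual.
- by apply/measurable_EFinP; exact: measurable_sqrt_dual.
- by move=> x; rewrite lee_fin powR_ge0.
Qed.

Let avg_dual i :
  avg (dual_weight (ps i) (w i)) a l = (dint rho L (S i) s / dvol L s)%:E.
Proof.
rewrite /avg [X in inve X]lebesgue_cube// inver gt_eqF ?exprn_gt0//.
rewrite EFinM; congr (_ * _)%E; rewrite dintK//; last 2 first.
- exact: rdual_weight_ge0.
- exact: box_integrable_dual.
rewrite dboxE -integral_cube//; last 2 first.
- by apply/measurable_EFinP; exact: measurable_rdual_weight.
- by move=> x; rewrite lee_fin rdual_weight_ge0.
apply: ae_eq_integral.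
- exact: measurable_cube.
- by apply: measurable_funTS; exact: measurable_dual_weight.
- by apply/measurable_EFinP/measurable_funTS; exact: measurable_rdual_weight.
- by apply: filterS (weights_ae_gt0 i) => x wx _; rewrite dual_weightE// gt_eqF.
Qed.

(** The B'_p inequality on the closed cube, solved for the measure of the tent after replacing the
    exponential by its lower bound [expeR_avg_ge]. The result is the hypothesis [M_le] of the tree
    argument. *)
Lemma tent_bound : (mu (dtent rho L s) <= (dvol L s * (fine (B'_const ps p mu w) *
  \prod_i (dvol L s / dint rho L (S i) s *
    (dint rho L (sqrt_dual ps w i) s / dvol L s) `^ (2 / ps i))) `^ p)%:E)%E.
Proof.
set B := fine _.
have BE : B'_const ps p mu w = B%:E by rewrite fineK// ge0_fin_numE// B'_const_ge0.
pose P := \prod_i (dint rho L (S i) s / dvol L s).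
pose Q := \prod_i (c i `^ (2 / ps i))^-1.
have P0 : 0 < P by apply: prodr_gt0 => i _; rewrite divr_gt0// dint_dual_gt0.
have Q0 : 0 < Q by apply: prodr_gt0 => i _; rewrite invr_gt0 powR_gt0.
have -> : \prod_i (dvol L s / dint rho L (S i) s * c i `^ (2 / ps i)) = (P * Q)^-1.
  rewrite -big_split/= -prodfV; apply: eq_bigr => i _.
  by rewrite !invfM !invrK (mulrC (dvol L s)).
have tent_sub : (mu (dtent rho L s) <= mu (cube_tent a l))%E.
  apply: le_measure; rewrite ?inE.
  - exact: measurable_dtent.
  - exact: measurable_cube_tent.
  - by move=> z [zs zl]; split => //; apply: hbox_sub_cube; rewrite -dboxE.
apply: le_trans tent_sub _.
have : ((mu (cube_tent a l) / (dvol L s)%:E) `^ p^-1 * (P * Q)%:E <= B%:E)%E.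
  rewrite -BE; apply: (@le_trans _ _ ((mu (cube_tent a l) / leb (cube a l)) `^ p^-1 *
        mule_oo (\prod_(i < m) avg (dual_weight (ps i) (w i)) a l)
          (expeR (avg (fun x =>
             lne (\prod_(i < m) epow (dual_weight (ps i) (w i) x) (- (ps i)^-1))) a l)))%E);
    last by apply: ereal_sup_ubound; exists a, l.
  rewrite [X in (_ <= (_ / X) `^ _ * _)%E]lebesgue_cube//.
  rewrite lee_wpmul2l ?poweR_ge0//.
  have -> : (\prod_(i < m) avg (dual_weight (ps i) (w i)) a l = P%:E)%E.
    by rewrite -prodEFin; apply: eq_bigr => i _; exact: avg_dual.
  rewrite /mule_oo /= EFinM lee_wpmul2l ?lee_fin ?(ltW P0)//.
  apply: expeR_avg_ge => //; exact: weights_ae_gt0.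
have [V0 PQ0] := (lt0r_neq0 v0, lt0r_neq0 (mulr_gt0 P0 Q0)).
have pn0 : p^-1 != 0 by rewrite invr_eq0 gt_eqF.
rewrite inver (negbTE V0); case muE : (mu (cube_tent a l)) => [M| |].
- have M0 : 0 <= M by rewrite -lee_fin -muE measure_ge0.
  rewrite !lee_fin.
  rewrite -ler_pdivlMr ?mulr_gt0// => MB.
  have MV0 : 0 <= M / dvol L s by rewrite divr_ge0// ltW.
  rewrite mulrC -ler_pdivrMr// -[leLHS](_ : ((M / dvol L s) `^ p^-1) `^ p = _).
    by apply: le_powR_base; rewrite ?powR_ge0// ltW.
  by rewrite -powRrM mulVf ?gt_eqF// powRr1.
(* A tent of infinite measure would contradict the finite bound [B], because [P * Q] is positive. *)
- rewrite mulyr gtr0_sg ?invr_gt0// mul1e poweRyr// mulyr.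
  by rewrite gtr0_sg ?mulr_gt0// mul1e leye_eq.
- by have : (0 <= mu (cube_tent a l))%E by []; rewrite muE.
Qed.

End tent_bound.

(** * Bound for the dyadic maximal operator *)

Section integral_sparse_sum.
Context d (Z : measurableType d) (R : realType) (T : Type) (C : finType).
Variable mu : {measure set Z -> \bar R}.
Variables (ch : C -> T -> T) (m : nat) (vol : T -> R) (F : 'I_m -> T -> R).
Variables (D : set Z) (E : T -> set Z) (b : T -> R).
Hypotheses (mD : measurable D) (mE : forall s, measurable (E s)).
Hypotheses (ED : forall s, E s `<=` D) (Efin : forall s, (mu (E s) < +oo)%E).
Hypothesis b0 : forall s, 0 <= b s.

Let f z s := (z \in E s)%:R * b s.

Let f0 z s : 0 <= f z s. Proof. by rewrite mulr_ge0. Qed.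

Let mf s : measurable_fun setT (f ^~ s).
Proof.
rewrite (_ : f ^~ s = fun z => \1_(E s) z * b s).
  by apply: measurable_funM => //; exact: measurable_indic.
by apply/funext => z; rewrite indicE.
Qed.

Lemma measurable_sparse_sum k u s :
  measurable_fun setT (fun z => sparse_sum ch vol F (f z) k u s).
Proof.
elim: k u s => [|k IH] u s /=; have [_|_] := ltP (stop_ratio m * u) (avg_prod vol F s) => //.
- by apply: measurable_funD => //; exact: mf.
- apply: measurable_funD; first exact: mf.
  by apply: measurable_sum => c; exact: IH.
- by apply: measurable_sum => c; exact: IH.
Qed.

Let intf s : (\int[mu]_(z in D) (f z s)%:E = (fine (mu (E s)) * b s)%:E)%E.
Proof.
rewrite (eq_integral (fun z => (b s)%:E * (\1_(E s) z)%:E))%E; last first.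
  by move=> z _; rewrite -EFinM mulrC.
rewrite ge0_integralZl//; last 2 first.
- by apply/measurable_EFinP/measurable_funTS; exact: measurable_indic.
- by rewrite lee_fin.
by rewrite integral_indic// setIidl// mulrC EFinM fineK// ge0_fin_numE.
Qed.

(** The stopping rule depends on the node averages and not on the point [z], so integration only
    replaces the indicator of each tent by its measure. *)
Lemma integral_sparse_sum k u s :
  (\int[mu]_(z in D) (sparse_sum ch vol F (f z) k u s)%:E =
   (sparse_sum ch vol F (fun s => fine (mu (E s)) * b s) k u s)%:E)%E.
Proof.
have mS j v x : measurable_fun D (fun z => (sparse_sum ch vol F (f z) j v x)%:E).
  by apply/measurable_EFinP/measurable_funTS; exact: measurable_sparse_sum.
have sumS j v x : (\int[mu]_(z in D) (\sum_c sparse_sum ch vol F (f z) j v (ch c x))%:E =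
    \sum_c \int[mu]_(z in D) (sparse_sum ch vol F (f z) j v (ch c x))%:E)%E.
  under eq_integral do rewrite -sumEFin.
  rewrite ge0_integral_sum// => c z _.
  by rewrite lee_fin sparse_sum_ge0.
elim: k u s => [|k IH] u s /=;
    have [_|_] := ltP (stop_ratio m * u) (avg_prod vol F s).
- by under eq_integral do rewrite addr0; rewrite addr0 intf.
- exact: integral0.
- under eq_integral do rewrite EFinD.
  rewrite ge0_integralD//.
  + rewrite intf sumS EFinD; congr (_ + _)%E.
    by rewrite -sumEFin; apply: eq_bigr => c _; exact: IH.
  + by move=> z _; rewrite lee_fin.
  + by apply/measurable_EFinP/measurable_funTS; exact: mf.
  + by move=> z _; rewrite lee_fin sumr_ge0// => c _; rewrite sparse_sum_ge0.
  + apply/measurable_EFinP/measurable_funTS.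
    by apply: measurable_sum => c; exact: measurable_sparse_sum.
- by rewrite sumS -sumEFin; apply: eq_bigr => c _; exact: IH.
Qed.

End integral_sparse_sum.

Section dyadic_bound.
Context {R : realType} {n m : nat}.
Local Notation leb := (lebesgue_Rn R n).
Variables (ps : 'I_m -> R) (p : R) (w : 'I_m -> Rn R n -> R).
Variable mu : {measure set (Rn R n * measurableTypeR R)%type -> \bar R}.
Hypotheses (ps1 : forall i, 1 < ps i) (p0 : 0 < p).
Hypothesis pE : p^-1 = \sum_i (ps i)^-1.
Hypotheses (mw : forall i, measurable_fun setT (w i)) (w0 : forall i x, 0 <= w i x).
Hypothesis B'_fin : B'_condition ps p mu w.
Hypothesis fin_dual : forall i a (l : R), 0 < l ->
  (\int[leb]_(x in cube a l) dual_weight (ps i) (w i) x < +oo)%E.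
Local Notation S i := (rdual_weight (ps i) (w i)).
Local Notation B := (fine (B'_const ps p mu w)).

Variables (g : 'I_m -> Rn R n -> R) (Y : 'I_m -> R).
Hypothesis mg : forall i, measurable_fun setT (g i).
Hypothesis gY : forall i,
  (\int[leb]_x (`|g i x| `^ ps i * w i x)%:E <= (Y i)%:E)%E.
Hypothesis Y0 : forall i, 0 < Y i.

Definition abs_fun i x : R := `|g i x|.
Definition power_fun i x : R := `|g i x| `^ ps i * w i x.

Let ps0 i : 0 < ps i. Proof. exact: lt_trans (ps1 i). Qed.

Let b i := carleson_cst (ps i).
Let b0 i : 0 < b i.
Proof. by rewrite mulr_gt0// addr_gt0// mulr_gt0// powR_gt0// powR_gt0. Qed.

Let mabs i : measurable_fun setT (abs_fun i).
Proof. exact: measurableT_comp (mg i). Qed.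

Let mpow i : measurable_fun setT (power_fun i).
Proof.
apply: measurable_funM => //.
exact: (measurableT_comp (measurable_powR _) (mabs i)).
Qed.

Let pow0 i x : 0 <= power_fun i x.
Proof. by rewrite mulr_ge0 ?powR_ge0. Qed.

(** Compare [b i * t] with [y * S i x], where [t] is the modulus of [g i x]. If the latter is at
    least as large, the second term on the right bounds the left side; otherwise the first does,
    since [w i x] is the inverse of [S i x] to the power [ps i - 1]. *)
Let young i x y : 0 <= y -> 0 < w i x ->
  b i * y `^ (ps i - 1) * abs_fun i x <=
  b i `^ ps i * power_fun i x + y `^ ps i * S i x.
Proof.
move=> y0 wx; rewrite /abs_fun /power_fun; set t := `|g i x|.
have t0 : 0 <= t by exact: normr_ge0.
have S0 : 0 < S i x by exact: rdual_weight_gt0.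
have q10 : 0 < ps i - 1 by rewrite subr_gt0.
have [bt|bt] := leP (b i * t) (y * S i x).
  rewrite -[leLHS]add0r lerD ?mulr_ge0 ?powR_ge0//.
  rewrite -(mulr_powRB1 y0 (ps0 i)) (mulrAC (b i)) (mulrAC y).
  by rewrite ler_wpM2r ?powR_ge0.
rewrite -[leLHS]addr0 lerD ?mulr_ge0 ?powR_ge0 ?(ltW S0)//.
have bt0 : 0 <= b i * t by rewrite mulr_ge0// ltW.
rewrite mulrA -powRM ?(ltW (b0 i))// -(mulr_powRB1 bt0 (ps0 i)).
rewrite (mulrAC (b i)) -(mulrA (b i * t)) ler_wpM2l//.
have -> : w i x = (S i x `^ (ps i - 1))^-1.
  by rewrite /rdual_weight -powRrM mulNr mulVf ?gt_eqF// powRN powRr1 ?ltW// invrK.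
rewrite ler_pdivlMr ?powR_gt0// -powRM//; last exact: ltW.
apply: le_powR_base; [exact: ltW|by rewrite mulr_ge0// ltW|exact: ltW].
Qed.

Let box_pow i : box_integrable (power_fun i).
Proof.
move=> a l l0; apply: (@le_lt_trans _ _ (Y i)%:E); last exact: ltry.
apply: le_trans (gY i); apply: ge0_subset_integral => //.
- exact: measurable_hbox.
- by apply/measurable_EFinP; exact: mpow.
- by move=> x _; rewrite lee_fin; exact: pow0.
Qed.

Let youngE i y D : measurable D -> 0 <= y ->
  ((b i * y `^ (ps i - 1))%:E * \int[leb]_(x in D) (abs_fun i x)%:E <=
   (b i `^ ps i)%:E * \int[leb]_(x in D) (power_fun i x)%:E +
   (y `^ ps i)%:E * \int[leb]_(x in D) (S i x)%:E)%E.
Proof.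
move=> mD y0; apply: ae_le_integral_lin => //.
- exact: measurable_rdual_weight.
- by move=> x; exact: normr_ge0.
- exact: rdual_weight_ge0.
- by rewrite mulr_ge0 ?powR_ge0// ltW.
- exact: powR_ge0.
- exact: powR_ge0.
- apply: filterS (weights_ae_gt0 ps1 mw w0 fin_dual i) => x wx.
  exact: young.
Qed.

(** The integrated Young inequality with [y = 1] takes the place of Hölder's inequality. *)
Lemma box_integrable_abs i : box_integrable (abs_fun i).
Proof.
move=> a l l0; have := @youngE i 1 _ (measurable_hbox a l) ler01.
rewrite !powR1 mulr1 mul1e => H.
rewrite -(@lte_pmul2l _ (b i)%:E) ?lte_fin//.
apply: le_lt_trans H _; rewrite mulry gtr0_sg// mul1e; apply: lte_add_pinfty.
  by rewrite lte_mul_pinfty ?lee_fin ?powR_ge0//; exact: box_pow.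
exact: box_integrable_dual.
Qed.

Let box_integrable1 : @box_integrable R n (cst 1).
Proof.
move=> a l l0; rewrite (_ : (fun x => _) = cst 1%E)// integral_cst; last first.
  exact: measurable_hbox.
by rewrite mul1e [ltLHS]lebesgue_hbox// ltry.
Qed.

Variables (rho : 'I_n -> R) (L : R).
Hypothesis L0 : 0 < L.

Local Notation F := (fun i => dint rho L (abs_fun i)).

Lemma dyadic_sum_bound k :
  sparse_sum (@dchild n) (dvol L) F
    (fun s => fine (mu (dtent rho L s)) * avg_prod (dvol L) F s `^ p) k 0 droot <=
  carleson_sum_cst p ps * B `^ p * \prod_i Y i `^ (p / ps i).
Proof.
have F0 i x : 0 <= abs_fun i x by exact: normr_ge0.
apply: (@sparse_sum_bound R _ _ _ m p ps (dvol L)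
  (fun s => fine (mu (dtent rho L s))) _ _ _ _ _
  (fun i => dint rho L (S i)) (fun i => dint rho L (sqrt_dual ps w i))
  (fun i => dint rho L (power_fun i))) => //.
- by move=> s; exact: dvol_gt0.
- move=> s; rewrite (@dvolE _ _ rho L)//.
  rewrite (dint_additive rho L0 (measurable_cst _) (fun=> ler01) box_integrable1).
  by apply: eq_bigr => c _; rewrite (@dvolE _ _ rho L).
- by move=> i s; exact: dint_ge0.
- by move=> i; exact: (dint_additive rho L0 (mabs i) (F0 i) (@box_integrable_abs i)).
- by move=> i s; exact: (dint_dual_gt0 ps1 mw w0 fin_dual).
- by move=> i s; apply: dint_ge0 => x; exact: powR_ge0.
- move=> i; apply: (dint_additive rho L0 _ (rdual_weight_ge0 _ _)).
    exact: measurable_rdual_weight.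
  exact: box_integrable_dual.
- move=> i; apply: (dint_additive rho L0 (measurable_sqrt_dual ps mw i)).
    by move=> x; exact: powR_ge0.
  exact: box_integrable_sqrt_dual.
- by move=> i; exact: (dint_additive rho L0 (mpow i) (@pow0 i) (@box_pow i)).
- move=> i s y y0; rewrite (@dvolE _ _ rho L)//.
  rewrite -lee_fin EFinD !EFinM !dintK//.
  + rewrite -EFinM; apply: ae_le_integral_lin => //.
    * exact: measurable_dbox.
    * exact: measurable_sqrt_dual.
    * exact: measurable_rdual_weight.
    * by move=> x; exact: powR_ge0.
    * exact: rdual_weight_ge0.
    * by rewrite mulr_ge0.
    * exact: sqr_ge0.
    * apply: aeW => x; rewrite /= mulr1 -(sqr_sqrt_dual ps w i x).
      (* Expanding this square gives [young_h] pointwise. *)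
      have := sqr_ge0 (2 * sqrt_dual ps w i x - y); rewrite sqrrB exprMn; lra.
  + exact: rdual_weight_ge0.
  + exact: box_integrable_dual.
  + by move=> x; exact: powR_ge0.
  + exact: box_integrable_sqrt_dual.
- move=> i s y y0; rewrite -lee_fin EFinD (EFinM (_ * _)) !(EFinM (_ `^ _)) !dintK//.
  + by apply: youngE => //; exact: measurable_dbox.
  + exact: rdual_weight_ge0.
  + exact: box_integrable_dual.
  + exact: box_integrable_abs.
- by apply: fine_ge0; exact: B'_const_ge0.
- move=> s; rewrite -lee_fin; have := tent_bound ps1 p0 mw w0 B'_fin fin_dual rho s L0.
  move=> tb; rewrite fineK//; rewrite ge0_fin_numE//.
  exact: le_lt_trans tb (ltry _).
- move=> i; rewrite -lee_fin dintK//.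
  apply: le_trans (gY i); apply: ge0_subset_integral => //.
  + exact: measurable_dbox.
  + by apply/measurable_EFinP; exact: mpow.
  + by move=> x _; rewrite lee_fin; exact: pow0.
Qed.

End dyadic_bound.

Lemma le_limn_einf (R : realType) (u : (\bar R)^nat) (c : \bar R) k0 :
  (forall k, (k0 <= k)%N -> c <= u k)%E -> (c <= limn_einf u)%E.
Proof.
move=> cu; rewrite limn_einf_lim; apply: lime_ge; first exact: is_cvg_einfs.
exists k0 => // j /= kj; apply: le_ereal_inf_tmp => _ [i /= ji <-].
by apply: cu; exact: leq_trans ji.
Qed.

Lemma limn_einf_le (R : realType) (u : (\bar R)^nat) (c : \bar R) :
  (forall k, u k <= c)%E -> (limn_einf u <= c)%E.
Proof.
move=> uc; rewrite limn_einf_lim; apply: lime_le; first exact: is_cvg_einfs.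
apply: nearW => j; apply: le_trans (uc j); apply: ereal_inf_lbound.
by exists j => //=.
Qed.

(** With root side [2 ^ k] and [2 * k] generations, the finest mesh is [2 ^ (-k)]. As [k] grows, the
    grids cover more of the space at finer resolution, so any fixed cube is within the range of
    [dyadic_cover] for all large [k]. *)
Lemma eventually_covered (R : realType) n (a : Rn R n) (l : R) : 0 < l ->
  exists k0, forall k (L := 2 ^+ k : R), (k0 <= k)%N -> [/\ 3 * l < L,
    forall i, - L / 3 <= tnth a i /\ tnth a i + l < L / 3 &
    L / 2 ^+ (k + k) <= 3 * l].
Proof.
move=> l0; pose N (x : R) := (Num.truncn x).+1.
have lN (x : R) k : (N x <= k)%N -> x < 2 ^+ k.
  move=> xk; apply: lt_trans (truncnS_gt x) _; rewrite -natrX ltr_nat.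
  by apply: leq_ltn_trans xk _; exact: ltn_expl.
exists (N (3 * l)%R + N (3 * l)^-1%R + \sum_i N (3 * (`|tnth a i| + l))%R)%N => k L kN.
have kN1 : (N (3 * l)%R <= k)%N by apply: leq_trans kN; rewrite -addnA leq_addr.
have kN2 : (N (3 * l)^-1%R <= k)%N by apply: leq_trans kN; rewrite addnAC leq_addl.
have L0 : 0 < L by exact: exprn_gt0.
split; first exact: lN.
  move=> i; have : (N (3 * (`|tnth a i| + l))%R <= k)%N.
    by apply: leq_trans kN; rewrite (bigD1 i)//= addnCA leq_addr.
  move=> /lN; rewrite -/L => ai.
  have := ler_norm (tnth a i); have := ler_norm (- tnth a i); rewrite normrN.
  by move=> ? ?; split; lra.
rewrite exprD invfM mulrA divff ?gt_eqF// mul1r.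
rewrite invf_ple ?posrE ?mulr_gt0//; apply: ltW; exact: lN.
Qed.

Lemma maximal_ge0 (R : realType) n m (f : 'I_m -> Rn R n -> \bar R)
    (z : Rn R n * measurableTypeR R) : half_space z -> (0 <= maximal f z)%E.
Proof.
move=> z0; have l0 : 0 < z.2 + 1 :> R by rewrite ltr_pwDr.
apply: (le_trans _ (ereal_sup_ubound _)); last first.
  exists z.1, (z.2 + 1); split; [exact: l0| |by rewrite lerDl|reflexivity].
  by move=> i; rewrite lexx lerDl ltW.
by apply: prode_ge0 => i _; exact: avg_ge0.
Qed.

(** * From dyadic boxes to arbitrary cubes *)

Section maximal_bound.
Context {R : realType} {n m : nat}.
Local Notation leb := (lebesgue_Rn R n).
Variables (ps : 'I_m -> R) (p : R) (w : 'I_m -> Rn R n -> R).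
Variable mu : {measure set (Rn R n * measurableTypeR R)%type -> \bar R}.
Hypotheses (ps1 : forall i, 1 < ps i) (p0 : 0 < p).
Hypothesis pE : p^-1 = \sum_i (ps i)^-1.
Hypotheses (mw : forall i, measurable_fun setT (w i)) (w0 : forall i x, 0 <= w i x).
Hypothesis B'_fin : B'_condition ps p mu w.
Hypothesis fin_dual : forall i a (l : R), 0 < l ->
  (\int[leb]_(x in cube a l) dual_weight (ps i) (w i) x < +oo)%E.
Local Notation B := (fine (B'_const ps p mu w)).

Variables (g : 'I_m -> Rn R n -> R) (Y : 'I_m -> R).
Hypothesis mg : forall i, measurable_fun setT (g i).
Hypothesis gY : forall i,
  (\int[leb]_x (`|g i x| `^ ps i * w i x)%:E <= (Y i)%:E)%E.
Hypothesis Y0 : forall i, 0 < Y i.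

(** The factors are the number of grids, the volume ratio [6 ^ n] of box to cube once for each of
    the [m] functions, the stopping ratio of the pointwise domination, and the constant of the
    sparse bound. *)
Definition maximal_cst : R := #|{ffun 'I_n -> bool}|%:R *
  (((6 ^+ n) ^+ m) `^ p * @stop_ratio R m `^ p * carleson_sum_cst p ps).

Let bi i : box_integrable (abs_fun g i).
Proof. exact: (box_integrable_abs ps1 mw w0 fin_dual mg gY). Qed.

Let rho (k : nat) (e : {ffun 'I_n -> bool}) i : R := third_shift (2 ^+ k) (e i).
Let F k e i := dint (rho k e) (2 ^+ k) (abs_fun g i).
Let phi k e := avg_prod (dvol (2 ^+ k)) (F k e).
Let T k e z := sparse_sum (@dchild n) (dvol (2 ^+ k)) (F k e)
  (fun s => (z \in dtent (rho k e) (2 ^+ k) s)%:R * phi k e s `^ p) (k + k) 0 droot.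
Let D := ((6 ^+ n) ^+ m) `^ p * @stop_ratio R m `^ p : R.
Let U k z := \sum_e D * T k e z.

Let L0 k : 0 < (2 : R) ^+ k. Proof. exact: exprn_gt0. Qed.
Let D0 : 0 <= D. Proof. by rewrite mulr_ge0 ?powR_ge0. Qed.
Let T0 k e z : 0 <= T k e z.
Proof. by apply: sparse_sum_ge0 => s; rewrite mulr_ge0 ?powR_ge0. Qed.

Let mT k e : measurable_fun setT (T k e).
Proof.
by apply: measurable_sparse_sum => s; exact: measurable_dtent.
Qed.

Let mU k : measurable_fun setT (U k).
Proof.
by apply: measurable_sum => e; apply: measurable_funM => //; exact: mT.
Qed.

Let le_U k a (l : R) (z : Rn R n * measurableTypeR R) :
  0 < l -> cube a l z.1 -> 0 <= z.2 <= l -> 3 * l < 2 ^+ k ->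
  (forall i, - 2 ^+ k / 3 <= tnth a i /\ tnth a i + l < 2 ^+ k / 3) ->
  2 ^+ k / 2 ^+ (k + k) <= 3 * l ->
  (\prod_i (fine (\int[leb]_(x in cube a l) (abs_fun g i x)%:E)%E / l ^+ n)) `^ p
    <= U k z.
Proof.
move=> l0 zQ /andP[z20 z2l] kl ka kk.
have [e [s [ds Qs /andP[ls sl]]]] := dyadic_cover l0 kl ka kk.
(* The strict inequality [l < dside] matters here: heights up to and including [l] must lie in a
   tent that is open at the top. *)
have zs : z \in dtent (rho k e) (2 ^+ k) s.
  rewrite inE; split; first exact: Qs.
  by rewrite z20 (le_lt_trans z2l ls).
have ln0 : 0 < l ^+ n by exact: exprn_gt0.
have Qphi : \prod_i (fine (\int[leb]_(x in cube a l) (abs_fun g i x)%:E)%E / l ^+ n)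
    <= (6 ^+ n) ^+ m * phi k e s.
  rewrite (_ : (6 ^+ n) ^+ m = \prod_(i < m) 6 ^+ n); last by rewrite prodr_const card_ord.
  rewrite /phi /avg_prod -big_split/=; apply: ler_prod => i _.
  have I0 : (0 <= \int[leb]_(x in cube a l) (abs_fun g i x)%:E)%E.
    by apply: integral_ge0 => x _; rewrite lee_fin normr_ge0.
  rewrite divr_ge0 ?fine_ge0 ?(ltW ln0)//=.
  have IF : fine (\int[leb]_(x in cube a l) (abs_fun g i x)%:E)%E <= F k e i s.
    have le1 : (\int[leb]_(x in cube a l) (abs_fun g i x)%:E <= (F k e i s)%:E)%E.
      rewrite /F dintK//; last by move=> x; exact: normr_ge0.
      apply: ge0_subset_integral => //.
      + exact: measurable_cube.
      + exact: measurable_dbox.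
      + apply/measurable_EFinP/measurable_funTS.
        exact: measurableT_comp (mg i).
      + by move=> x _; rewrite lee_fin; exact: normr_ge0.
    rewrite -lee_fin fineK// ge0_fin_numE//; exact: le_lt_trans le1 (ltry _).
  have F0 : 0 <= F k e i s by apply: dint_ge0 => x; exact: normr_ge0.
  have v0 := dvol_gt0 (L0 k) s.
  rewrite mulrCA; apply: ler_pM => //; first by rewrite fine_ge0.
    by rewrite invr_ge0 ltW.
  rewrite ler_pdivlMr// mulrC ler_pdivrMr// -exprMn.
  by apply: lerXn2r => //; rewrite nnegrE ltW// ?mulr_gt0// (lt_trans l0).
have prod0 : 0 <= \prod_i (fine (\int[leb]_(x in cube a l) (abs_fun g i x)%:E)%E / l ^+ n).
  apply: prodr_ge0 => i _; rewrite divr_ge0 ?(ltW ln0)// fine_ge0//.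
  by apply: integral_ge0 => x _; rewrite lee_fin normr_ge0.
have phi0 : 0 <= phi k e s.
  apply: avg_prod_ge0 => [x|i x]; first exact: dvol_gt0.
  by apply: dint_ge0 => y; exact: normr_ge0.
apply: le_trans (le_powR_base (ltW p0) prod0 Qphi) _.
rewrite powRM ?exprn_ge0//.
have T_phi : phi k e s `^ p <= @stop_ratio R m `^ p * T k e z.
  have := @avg_prod_le_sparse _ _ (@dchild n) R m p (dvol (2 ^+ k)) (F k e)
    (fun s => z \in dtent (rho k e) (2 ^+ k) s) (k + k) 0 droot s.
  case=> //.
  - by move=> x; exact: dvol_gt0.
  - by move=> i x; apply: dint_ge0 => y; exact: normr_ge0.
  - move=> c x; rewrite !inE => -[xc /andP[x1 x2]]; split; first exact: dbox_child xc.
    rewrite x1 (lt_le_trans x2)// dside_child ler_pdivrMr// ler_peMr ?ler1n//.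
    by rewrite ltW// dside_gt0.
  - exact: ltW.
  (* The stopping process starts from the value 0, so a box with no stopping ancestor has a
     vanishing product of averages. *)
  - rewrite mulr0 => phi_le0; have -> : phi k e s = 0.
      by apply/eqP; rewrite eq_le phi0 andbT.
    by rewrite powR0 ?gt_eqF// mulr_ge0 ?powR_ge0.
rewrite /U (bigD1 e)//= -[leLHS]addr0 lerD//.
  by rewrite /D -mulrA ler_wpM2l// powR_ge0.
by apply: sumr_ge0 => e' _; rewrite mulr_ge0.
Qed.

Let int_U k : (\int[mu]_(z in half_space) (U k z)%:E <=
  (maximal_cst * B `^ p * \prod_i Y i `^ (p / ps i))%:E)%E.
Proof.
rewrite (eq_integral (fun z => \sum_e D%:E * (T k e z)%:E)%E); last first.
  by move=> z _; rewrite -sumEFin; apply: eq_bigr => e _; rewrite EFinM.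
have mD := @measurable_half_space R n.
rewrite ge0_integral_sum//; last 2 first.
- move=> e; apply: emeasurable_funM; first exact: measurable_cst.
  by apply/measurable_EFinP/measurable_funTS; exact: mT.
- by move=> e z _; rewrite -EFinM lee_fin mulr_ge0.
pose K := D * (carleson_sum_cst p ps * B `^ p * \prod_i Y i `^ (p / ps i)).
apply: (@le_trans _ _ (\sum_(e : {ffun 'I_n -> bool}) K%:E)%E); last first.
  rewrite sumEFin lee_fin sumr_const -mulr_natl /maximal_cst -/D /K.
  by rewrite le_eqVlt; apply/orP; left; apply/eqP; ring.
apply: lee_sum => e _; rewrite ge0_integralZl//; last 2 first.
- by apply/measurable_EFinP/measurable_funTS; exact: mT.
- by move=> z _; rewrite lee_fin.
rewrite /K (EFinM D) lee_wpmul2l ?lee_fin//.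
rewrite (@integral_sparse_sum _ _ R _ _ mu (@dchild n) m (dvol (2 ^+ k)) (F k e)
  half_space (dtent (rho k e) (2 ^+ k)) (fun s => phi k e s `^ p)) //.
- rewrite lee_fin.
  exact: (dyadic_sum_bound ps1 p0 pE mw w0 B'_fin fin_dual mg gY Y0 (rho k e) (L0 k) (k + k)).
- by move=> s; exact: measurable_dtent.
- by move=> s z [_ /andP[]].
- move=> s; have := tent_bound ps1 p0 mw w0 B'_fin fin_dual (rho k e) s (L0 k).
  by move=> tb; exact: le_lt_trans tb (ltry _).
- by move=> s; exact: powR_ge0.
Qed.

(** Each cube is covered at every large [k], so the power [p] of the maximal function is at most the
    lower limit of the dyadic majorants [U k]. Their integrals are bounded uniformly in [k], and
    Fatou's lemma applies. *)
Lemma integral_maximal_bound :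
  (\int[mu]_(z in half_space) (`|maximal (fun i x => (g i x)%:E) z| `^ p) <=
  (maximal_cst * B `^ p * \prod_i Y i `^ (p / ps i))%:E)%E.
Proof.
pose v z := limn_einf (fun k => (U k z)%:E).
have U0 k z : (0 <= (U k z)%:E)%E.
  by rewrite lee_fin sumr_ge0// => e _; rewrite mulr_ge0.
have pn0 : p != 0 by rewrite gt_eqF.
apply: (@le_trans _ _ (\int[mu]_(z in half_space) v z)%E); last first.
  apply: (@le_trans _ _ (limn_einf (fun k => \int[mu]_(z in half_space) (U k z)%:E)%E)).
    apply: fatou => //; first exact: measurable_half_space.
    by move=> k; apply/measurable_EFinP/measurable_funTS; exact: mU.
  by apply: limn_einf_le => k; exact: int_U.
apply: ge0_le_integral_nomeas => z z0; first exact: poweR_ge0.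
have v0 : (0 <= v z)%E by apply: (@le_limn_einf _ _ _ 0%N).
(* Taking the root first leaves a bare supremum on the left, which can be bounded one cube at a
   time. *)
suff Mv : (`|maximal (fun i x => (g i x)%:E) z| <= v z `^ p^-1)%E.
  have := gt0_ler_poweR (ltW p0) _ _ Mv.
  rewrite !in_itv/= !leey !andbT abse_ge0 poweR_ge0 => /(_ isT isT).
  by rewrite -poweRrM mulVf// poweRe1.
rewrite gee0_abs; last exact: maximal_ge0.
apply: ge_ereal_sup => y [a [l [l0 zQ zl ->]]].
pose A i := fine (\int[leb]_(x in cube a l) (abs_fun g i x)%:E)%E / l ^+ n.
have A0 i : 0 <= A i.
  rewrite divr_ge0 ?exprn_ge0 ?(ltW l0)// fine_ge0//.
  by apply: integral_ge0 => x _; rewrite lee_fin; exact: normr_ge0.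
have -> : (\prod_(i < m) avg (fun x => `|(g i x)%:E|) a l = (\prod_i A i)%:E)%E.
  rewrite -prodEFin; apply: eq_bigr => i _.
  rewrite /avg [X in inve X]lebesgue_cube// inver gt_eqF ?exprn_gt0//.
  rewrite /A EFinM fineK// ge0_fin_numE; last first.
    by apply: integral_ge0 => x _; rewrite lee_fin; exact: normr_ge0.
  rewrite integral_cube//; first exact: bi.
  - by apply/measurable_EFinP; exact: measurableT_comp (mg i).
  - by move=> x; rewrite lee_fin; exact: normr_ge0.
have Ap0 : 0 <= \prod_i A i by exact: prodr_ge0.
have [k0 k0P] := eventually_covered a l0.
have Apv : (((\prod_i A i) `^ p)%:E <= v z)%E.
  apply: (@le_limn_einf _ _ _ k0) => k /k0P[kl ka kk]; rewrite lee_fin.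
  by apply: le_U => //; rewrite z0.
have := gt0_ler_poweR (_ : 0 <= p^-1) _ _ Apv.
rewrite !in_itv/= !leey !andbT lee_fin powR_ge0 invr_ge0 (ltW p0) v0.
by move=> /(_ isT isT isT); rewrite -powRrM divff// powRr1.
Qed.

End maximal_bound.

(** * Equivalence of the two inequalities *)

Lemma lee_prod (R : realType) (I : finType) (f g : I -> \bar R) :
  (forall i, 0 <= f i <= g i)%E -> (\prod_i f i <= \prod_i g i)%E.
Proof.
move=> fg; suff /andP[] : (0 <= \prod_i f i <= \prod_i g i)%E by [].
elim/big_ind2: _ => [|x1 x2 y1 y2 /andP[x0 x12] /andP[y0 y12]|i _]; last exact: fg.
  by rewrite lee01 lexx.
by rewrite mule_ge0//= lee_pmul.
Qed.

Section smallest_constant.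
Context {R : realType} {A : Type}.
Variables (Q : A -> Prop) (h X : A -> \bar R).

Definition bounded_by (C : R) := forall f, Q f -> (h f <= C%:E * X f)%E.

(** For finite [X f] the bound on [h f] is a closed condition on [C], so the infimum of the
    admissible constants is itself admissible. *)
Lemma smallest_constant_exists (C0 : R) :
  (forall f, Q f -> (0 <= X f < +oo)%E) -> 0 <= C0 -> bounded_by C0 ->
  exists2 N, smallest_constant bounded_by N & N <= C0.
Proof.
move=> X0 C00 PC0; pose S := [set C : R | 0 <= C /\ bounded_by C].
have SC0 : S C0 by [].
have S0 : lbound S 0 by move=> C [].
have infS : has_inf S by split; [exists C0|exists 0].
exists (inf S); last by apply: ge_inf => //; exists 0.
split.
- by apply: lb_le_inf => //; exists C0.
- move=> f Qf; have /andP[+ +] := X0 f Qf.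
  have := fun C (SC : S C) => SC.2 f Qf.
  case: (X f) => [x| |]// hS; rewrite lee_fin => x0 _.
  have := hS _ SC0; case: (h f) hS => [y| |]// hS _; last by rewrite leNye.
  have hS' C : S C -> y <= C * x by move=> /hS; rewrite -EFinM lee_fin.
  rewrite -EFinM lee_fin; move: x0; rewrite le_eqVlt => /predU1P[x0|x0].
    by have := hS' _ SC0; rewrite -x0 !mulr0.
  rewrite -ler_pdivrMr//; apply: lb_le_inf; first by exists C0.
  by move=> C /hS' ; rewrite ler_pdivrMr.
- by move=> C C00' PC; apply: ge_inf; [exists 0|].
Qed.

End smallest_constant.

(** * Infinite dual weights *)

Section trivial_case.
Context {R : realType} {n m : nat}.
Local Notation leb := (lebesgue_Rn R n).
Variables (ps : 'I_m -> R) (p : R) (w : 'I_m -> Rn R n -> R).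
Variable mu : {measure set (Rn R n * measurableTypeR R)%type -> \bar R}.
Hypotheses (ps1 : forall i, 1 < ps i) (p0 : 0 < p).
Hypotheses (mw : forall i, measurable_fun setT (w i)) (w0 : forall i x, 0 <= w i x).
Hypothesis B'_fin : B'_condition ps p mu w.

(** Ensures that a product of averages is infinite as soon as one factor is. *)
Lemma avg_dual_weight_gt0 i a (l : R) : 0 < l ->
  (0 < avg (dual_weight (ps i) (w i)) a l)%E.
Proof.
move=> l0; rewrite /avg [X in inve X]lebesgue_cube// inver gt_eqF ?exprn_gt0//.
rewrite mule_gt0 ?lte_fin ?invr_gt0 ?exprn_gt0//.
have I0 : (0 <= \int[leb]_(x in cube a l) dual_weight (ps i) (w i) x)%E.
  by apply: integral_ge0 => x _; exact: dual_weight_ge0.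
rewrite lt_neqAle I0 andbT; apply/eqP => /esym I00.
have mQ : measurable (cube a l) by exact: measurable_cube.
have : ae_eq leb (cube a l) (dual_weight (ps i) (w i)) (cst 0%E).
  apply/(ae_eq_integral_abs _ _) => //.
    by apply: measurable_funTS; exact: measurable_dual_weight.
  rewrite -I00; apply: eq_integral => x _.
  by rewrite gee0_abs// dual_weight_ge0.
case=> N [mN N0 subN].
have : (leb (cube a l) <= leb N)%E.
  apply: le_measure; rewrite ?inE// => x xQ; apply: subN => /= /(_ xQ) d0.
  by have := dual_weight_gt0 (ps1 i) (w0 i) x; rewrite d0 ltxx.
by rewrite N0 leNgt [X in (_ < X)%E]lebesgue_cube// lte_fin exprn_gt0.
Qed.

(** By the convention in [mule_oo] the last factor of the B'_p expression is [+oo] on this cube, so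
    a tent of positive measure would make the constant infinite. *)
Lemma tent_null i a (l : R) : 0 < l ->
  (\int[leb]_(x in cube a l) dual_weight (ps i) (w i) x = +oo)%E ->
  mu (cube_tent a l) = 0%E.
Proof.
move=> l0 Ioo; apply/eqP; apply: contraT => mu0.
have ln0 : 0 < l ^+ n by exact: exprn_gt0.
suff : B'_const ps p mu w = +oo%E by move=> E; move: B'_fin; rewrite /B'_condition E.
apply/eqP; rewrite -leye_eq; apply: (le_trans _ (ereal_sup_ubound _)); last first.
  by exists a, l; split; [exact: l0|reflexivity].
have avgoo : avg (dual_weight (ps i) (w i)) a l = +oo%E.
  rewrite /avg Ioo [X in inve X]lebesgue_cube// inver gt_eqF//.
  by rewrite gt0_mulye// lte_fin invr_gt0.
have -> : (\prod_(j < m) avg (dual_weight (ps j) (w j)) a l = +oo)%E.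
  rewrite (bigD1 i)//= avgoo gt0_mulye//.
  elim/big_ind: _ => [//|x y|j _]; first exact: mule_gt0.
  exact: avg_dual_weight_gt0.
rewrite /mule_oo eqxx gt0_muley ?lexx//; apply: poweR_gt0.
rewrite [X in inve X]lebesgue_cube// inver gt_eqF// mule_gt0 ?lte_fin ?invr_gt0//.
by rewrite lt_neqAle eq_sym mu0 measure_ge0.
Qed.

(** Concentric enlargements of the cube still have infinite dual integral, so their tents are null
    as well, and these tents exhaust the half-space. *)
Lemma half_space_null i a (l : R) : 0 < l ->
  (\int[leb]_(x in cube a l) dual_weight (ps i) (w i) x = +oo)%E ->
  mu half_space = 0%E.
Proof.
move=> l0 Ioo; pose a' k : Rn R n := [tuple tnth a j - k%:R | j < n].
pose l' k : R := l + 2 * k%:R.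
have l'0 k : 0 < l' k by rewrite ltr_wpDr// mulr_ge0.
have Q'oo k : (\int[leb]_(x in cube (a' k) (l' k)) dual_weight (ps i) (w i) x = +oo)%E.
  apply/eqP; rewrite -leye_eq -Ioo; apply: ge0_subset_integral.
  - exact: measurable_cube.
  - exact: measurable_cube.
  - by apply: measurable_funTS; exact: measurable_dual_weight.
  - by move=> x _; exact: dual_weight_ge0.
  - move=> x xa j; have /andP[x1 x2] := xa j; rewrite tnth_mktuple /l'.
    by have := ler0n R k; move=> k0; apply/andP; split; lra.
have sub : half_space `<=` \bigcup_k (cube_tent (a' k) (l' k)).
  move=> [x t] /= t0; have lt_trunc (y : R) := truncnS_gt y.
  pose r j : R := `|tnth x j| + `|tnth a j|.
  pose K := ((Num.truncn t).+1 + \sum_j (Num.truncn (r j)).+1)%N.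
  have tK : t < K%:R by apply: lt_le_trans (lt_trunc t) _; rewrite ler_nat leq_addr.
  have rK j : r j < K%:R.
    apply: lt_le_trans (lt_trunc (r j)) _; rewrite ler_nat /K (bigD1 j)//=.
    by rewrite addnCA leq_addr.
  exists K => //; split => [j|]/=; last first.
    apply/andP; split; first exact: t0.
    by have := ler0n R K; rewrite /l'; lra.
  rewrite tnth_mktuple /l'; have := rK j; rewrite /r.
  have := ler_norm (tnth x j); have := ler_norm (- tnth x j).
  have := ler_norm (tnth a j); have := ler_norm (- tnth a j); rewrite !normrN.
  by move=> *; apply/andP; split; lra.
apply: measure_negligible; first exact: measurable_half_space.
apply: negligibleS sub _; apply: negligible_bigcup => k.
apply/negligibleP; first exact: measurable_cube_tent.
by apply: (@tent_null i) => //; exact: Q'oo.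
Qed.

End trivial_case.

Section half_space_norm.
Context {R : realType} {n m : nat}.
Variable mu : {measure set (Rn R n * measurableTypeR R)%type -> \bar R}.

Lemma half_space_norm_null (p : R) F : 0 < p -> mu half_space = 0%E ->
  half_space_norm (n := n) mu p F = 0%E.
Proof.
move=> p0 mu0; rewrite /half_space_norm integral_null_set//.
- by rewrite poweR0r// invr_eq0 gt_eqF.
- exact: measurable_half_space.
- by move=> z _; exact: poweR_ge0.
Qed.

Lemma eq_maximal (f h : 'I_m -> Rn R n -> \bar R) :
  (forall i, measurable_fun setT (f i)) -> (forall i, measurable_fun setT (h i)) ->
  (forall i, {ae lebesgue_Rn R n, forall x, f i x = h i x}) ->
  maximal f = maximal h.
Proof.
move=> mf mh fh; apply/funext => z; congr ereal_sup; apply/seteqP.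
have E a (l : R) : (\prod_(i < m) avg (fun x => `|f i x|) a l =
    \prod_(i < m) avg (fun x => `|h i x|) a l)%E.
  apply: eq_bigr => i _; congr (_ * _)%E; apply: ae_eq_integral.
  - exact: measurable_cube.
  - by apply: measurable_funTS; exact: measurableT_comp (mf i).
  - by apply: measurable_funTS; exact: measurableT_comp (mh i).
  - by apply: filterS (fh i) => x -> _.
by split=> y [a [l [l0 zQ zl ->]]]; exists a, l; rewrite E.
Qed.

End half_space_norm.

Section equivalence.
Context {R : realType} {n m : nat}.
Local Notation leb := (lebesgue_Rn R n).
Variables (ps : 'I_m -> R) (p : R) (w : 'I_m -> Rn R n -> R).
Variable mu : {measure set (Rn R n * measurableTypeR R)%type -> \bar R}.
Hypotheses (ps1 : forall i, 1 < ps i) (p0 : 0 < p).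
Hypotheses (mw : forall i, measurable_fun setT (w i)) (w0 : forall i x, 0 <= w i x).
Hypothesis w_pos : forall i, {ae leb, forall x, 0 < w i x}.
Local Notation S i := (rdual_weight (ps i) (w i)).
Local Notation sigma i := (dual_weight (ps i) (w i)).

Let ps0 i : 0 < ps i. Proof. exact: lt_trans (ps1 i). Qed.

(** Substitute [g i = f i * S i]. The integrands of the two norms agree where [w i] is positive;
    where it vanishes, the one for [g i] is 0, so the norm of [g i] is at most that of [f i]. *)
Lemma strong_bound_dual (C : R) : 0 <= C ->
  strong_bound ps p mu w C -> dual_strong_bound ps p mu w C.
Proof.
move=> C0 sb sg f fL; pose g i x := f i x * S i x.
have mf i : measurable_fun setT (f i) by have [] := fL i.
have mg i : measurable_fun setT (g i).
  by apply: measurable_funM => //; exact: measurable_rdual_weight.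
have gf i : (weighted_norm (ps i) (fun x => (w i x)%:E) (g i) <=
    weighted_norm (ps i) (sigma i) (f i))%E.
  apply: gt0_ler_poweR; rewrite ?in_itv/= ?leey ?andbT.
  - by rewrite invr_ge0 ltW.
  - apply: integral_ge0 => x _; rewrite mule_ge0 ?poweR_ge0 ?lee_fin//.
  - apply: integral_ge0 => x _; rewrite mule_ge0 ?poweR_ge0// dual_weight_ge0//.
  apply: le_integral_nomeas => x _; rewrite dual_weightE//.
  have [wx|wx] := eqVneq (w i x) 0.
    by rewrite wx mule0 mule_ge0 ?poweR_ge0.
  have wxgt : 0 < w i x by rewrite lt_neqAle eq_sym wx w0.
  rewrite /g ?poweR_EFin -?EFinM lee_fin normrM powRM//.
  by rewrite (ger0_norm (rdual_weight_ge0 _ _ _)) -mulrA rdual_weightM.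
have gL i : weighted_Lp (ps i) (fun x => (w i x)%:E) (g i).
  by split => //; apply: le_lt_trans (gf i) _; have [] := fL i.
rewrite (_ : maximal _ = maximal (fun i x => (g i x)%:E)).
  apply: le_trans (sb g gL) _; rewrite lee_wpmul2l ?lee_fin//.
  by apply: lee_prod => i; rewrite poweR_ge0 gf.
apply: eq_maximal => i.
- apply: emeasurable_funM; first exact/measurable_EFinP.
  exact: measurable_dual_weight.
- exact/measurable_EFinP.
- apply: filterS (w_pos i) => x wx.
  by rewrite /sg dual_weightE// gt_eqF// -EFinM.
Qed.

Lemma dual_bound_strong (C : R) :
  dual_strong_bound ps p mu w C -> strong_bound ps p mu w C.
Proof.
move=> sb v g gL; pose f i x := g i x * (S i x)^-1.
have mg i : measurable_fun setT (g i) by have [] := gL i.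
have mf i : measurable_fun setT (f i).
  apply: measurable_funM => //.
  rewrite (_ : (fun x => _) = fun x => w i x `^ (ps i - 1)^-1).
    exact: (measurableT_comp (measurable_powR _)).
  by apply/funext => x; rewrite /rdual_weight powRN invrK.
have fg i : (weighted_norm (ps i) (sigma i) (f i) =
    weighted_norm (ps i) (fun x => (w i x)%:E) (g i))%E.
  congr (_ `^ _)%E; apply: eq_integral => x _; rewrite dual_weightE//.
  have [wx|wx] := eqVneq (w i x) 0.
    (* The value 0 of [S i] and of its inverse makes [f i] vanish here, so the infinite [sigma i] is
       multiplied by 0. *)
    rewrite /f rdual_weight0// invr0 mulr0 normr0 poweR0r ?gt_eqF//.
    by rewrite mul0e wx mule0.
  have wxgt : 0 < w i x by rewrite lt_neqAle eq_sym wx w0.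
  have Sx : 0 < S i x by exact: rdual_weight_gt0.
  rewrite /f !poweR_EFin -!EFinM normrM powRM// -mulrA; congr (_ * _)%:E.
  rewrite normfV gtr0_norm// -{2}(rdual_weightM _ _ wxgt)//.
  by rewrite mulrA -powRM ?invr_ge0 ?ltW// mulVf ?gt_eqF// powR1 mul1r.
have fL i : weighted_Lp (ps i) (sigma i) (f i).
  by split => //; rewrite fg; have [] := gL i.
rewrite (_ : maximal _ = maximal (fun i x => (f i x)%:E * sigma i x)%E).
  apply: le_trans (sb f fL) _; under eq_bigr do rewrite fg.
  exact: lexx.
apply: eq_maximal => i.
- exact/measurable_EFinP.
- apply: emeasurable_funM; first exact/measurable_EFinP.
  exact: measurable_dual_weight.
- apply: filterS (w_pos i) => x wx.
  rewrite dual_weightE// gt_eqF// -EFinM /f divfK//.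
  by rewrite gt_eqF// rdual_weight_gt0.
Qed.

End equivalence.

(** * The main theorem *)

Section strong_bound.
Context {R : realType} {n m : nat}.
Local Notation leb := (lebesgue_Rn R n).
Variables (ps : 'I_m -> R) (p : R) (w : 'I_m -> Rn R n -> R).
Variable mu : {measure set (Rn R n * measurableTypeR R)%type -> \bar R}.
Hypotheses (ps1 : forall i, 1 < ps i) (p0 : 0 < p).
Hypothesis pE : p^-1 = \sum_i (ps i)^-1.
Hypotheses (mw : forall i, measurable_fun setT (w i)) (w0 : forall i x, 0 <= w i x).
Hypothesis B'_fin : B'_condition ps p mu w.
Hypothesis fin_dual : forall i a (l : R), 0 < l ->
  (\int[leb]_(x in cube a l) dual_weight (ps i) (w i) x < +oo)%E.

Let ps0 i : 0 < ps i. Proof. exact: lt_trans (ps1 i). Qed.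

Lemma maximal_cst_ge0 : 0 <= maximal_cst (n := n) ps p.
Proof.
rewrite /maximal_cst /carleson_sum_cst !mulr_ge0 ?powR_ge0//.
apply: sumr_ge0 => i _; rewrite mulr_ge0 ?powR_ge0// divr_ge0 ?(ltW p0)//.
exact: ltW.
Qed.

(** Handles a vanishing norm, which the normalization by [Y i > 0] excludes: then [g i] is zero
    almost everywhere, and so is every product of averages. *)
Let maximal_null (g : 'I_m -> Rn R n -> R) i z : half_space z ->
  measurable_fun setT (g i) ->
  (\int[leb]_x (`|g i x| `^ ps i * w i x)%:E = 0)%E ->
  maximal (fun i x => (g i x)%:E) z = 0%E.
Proof.
move=> z0 mg I0; have mabs : measurable_fun setT (fun x => `|g i x|).
  exact: measurableT_comp mg.
have g0 : {ae leb, forall x, `|g i x| = 0}.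
  have : ae_eq leb setT (fun x => (`|g i x| `^ ps i * w i x)%:E) (cst 0%E).
    apply/(ae_eq_integral_abs _ _) => //.
      apply/measurable_EFinP; apply: measurable_funM => //.
      exact: (measurableT_comp (measurable_powR _) mabs).
    rewrite -[RHS]I0; apply: eq_integral => x _.
    by rewrite gee0_abs// lee_fin mulr_ge0 ?powR_ge0.
  have wpos := weights_ae_gt0 ps1 mw w0 fin_dual i.
  apply: filterS2 wpos => x wx /(_ I)[] /eqP.
  by rewrite mulf_eq0 (gt_eqF wx) orbF powR_eq0 => /andP[/eqP].
apply/eqP; rewrite eq_le maximal_ge0// andbT.
apply: ge_ereal_sup => y [a [l [l0 _ _ ->]]].
rewrite (bigD1 i)//= /avg (_ : (\int[leb]_(x in cube a l) _)%E = 0%E) ?mul0e//.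
rewrite -(integral0 leb (cube a l)); apply: ae_eq_integral => //.
- exact: measurable_cube.
- by apply/measurable_EFinP/measurable_funTS.
- by apply: filterS g0 => x gx _; rewrite /= gx.
Qed.

Lemma strong_bound_B' : strong_bound ps p mu w
  (maximal_cst (n := n) ps p `^ p^-1 * fine (B'_const ps p mu w)).
Proof.
move=> f fL; pose v i x := (w i x)%:E; set B := fine _.
have mf i : measurable_fun setT (f i) by have [] := fL i.
have B0 : 0 <= B by apply: fine_ge0; exact: B'_const_ge0.
pose J i := (\int[leb]_x (`|f i x| `^ ps i * w i x)%:E)%E.
have J0 i : (0 <= J i)%E.
  by apply: integral_ge0 => x _; rewrite lee_fin mulr_ge0 ?powR_ge0.
have normE i : weighted_norm (ps i) (v i) (f i) = (J i `^ (ps i)^-1)%E by [].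
have Joo i : (J i < +oo)%E.
  have [_] := fL i; rewrite normE; apply: lty_poweRy.
  by rewrite invr_eq0 gt_eqF.
have JE i : J i = (fine (J i))%:E by rewrite fineK// ge0_fin_numE.
have pn0 : p^-1 != 0 by rewrite invr_eq0 gt_eqF.
have [/existsP[i /eqP Ji]|] := boolP [exists i, J i == 0%E].
  rewrite /half_space_norm (_ : (\int[mu]_(z in half_space) _)%E = 0%E).
    rewrite poweR0r// mule_ge0 ?lee_fin ?mulr_ge0 ?powR_ge0//.
    by apply: prode_ge0 => j _; exact: poweR_ge0.
  apply: integral0_eq => z z0; rewrite (maximal_null z0 (mf i) Ji) abse0.
  by rewrite poweR0r// gt_eqF.
rewrite negb_exists => /forallP Jn0.
have Y0 i : 0 < fine (J i).
  by rewrite -lte_fin -JE lt_neqAle eq_sym Jn0 J0.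
have JY i : (J i <= (fine (J i))%:E)%E by rewrite -JE.
have := integral_maximal_bound ps1 p0 pE mw w0 B'_fin fin_dual mf JY Y0.
rewrite -/B; set K := maximal_cst _ _; set I := (\int[mu]_(z in _) _)%E => IK.
have K0 : 0 <= K by exact: maximal_cst_ge0.
clearbody K.
have I0 : (0 <= I)%E by apply: integral_ge0 => z _; exact: poweR_ge0.
have := gt0_ler_poweR (_ : 0 <= p^-1) _ _ IK.
rewrite !in_itv/= !leey !andbT I0 invr_ge0 (ltW p0) lee_fin.
have P0 : 0 <= \prod_i fine (J i) `^ (p / ps i).
  by apply: prodr_ge0 => i _; exact: powR_ge0.
rewrite !mulr_ge0 ?powR_ge0// => /(_ isT isT isT) H.
apply: le_trans H _.
rewrite (eq_bigr (fun i => (fine (J i) `^ (ps i)^-1)%:E)); last first.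
  by move=> i _; rewrite normE {1}JE.
rewrite prodEFin -EFinM lee_fin le_eqVlt; apply/orP; left; apply/eqP.
rewrite !powRM ?mulr_ge0 ?powR_ge0// -powRrM divff ?gt_eqF// powRr1//.
congr (_ * _); rewrite powR_prod => [|i]; last exact: powR_ge0.
apply: eq_bigr => i _; rewrite -powRrM; congr (_ `^ _).
by rewrite mulrAC divff ?gt_eqF// mul1r.
Qed.

End strong_bound.

Theorem theorem1p5 (R : realType) (m n : nat) (hm : (1 <= m)%N)
    (hn : (1 <= n)%N) (ps : 'I_m -> R) (hps : forall i, 1 < ps i)
    (p : R) (hp : p^-1 = \sum_(i < m) (ps i)^-1) :
  exists c : R, 0 < c /\
    forall (mu : {measure set (Rn R n * measurableTypeR R)%type -> \bar R})
      (w : 'I_m -> Rn R n -> R),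
      (forall i, weight (w i)) ->
      B'_condition ps p mu w ->
      [/\ exists C : R, 0 < C /\ strong_bound ps p mu w C,
          exists C : R, 0 < C /\ dual_strong_bound ps p mu w C &
          exists N N' : R,
            [/\ smallest_constant (strong_bound ps p mu w) N,
                smallest_constant (dual_strong_bound ps p mu w) N',
                N = N' &
                (N%:E <= c%:E * B'_const ps p mu w)%E]].
Proof.
have p0 : 0 < p.
  rewrite -invr_gt0 hp (bigD1 (Ordinal hm))//= ltr_pwDl//.
    by rewrite invr_gt0 (lt_trans _ (hps _)).
  by apply: sumr_ge0 => i _; rewrite invr_ge0 ltW// (lt_trans _ (hps _)).
pose K := maximal_cst (n := n) ps p `^ p^-1.
have K0 : 0 <= K by exact: powR_ge0.
(* The bound holds with [K], which is only known to be nonnegative; adding 1 makes the constant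
   positive. *)
exists (K + 1); split; first by rewrite ltr_wpDl.
move=> mu w hw Bfin; set B := fine (B'_const ps p mu w).
have BE : B'_const ps p mu w = B%:E by rewrite fineK// ge0_fin_numE// B'_const_ge0.
have B0 : 0 <= B by apply: fine_ge0; exact: B'_const_ge0.
have mw i : measurable_fun setT (w i) by have [] := hw i.
have w0 i x : 0 <= w i x by have [] := hw i.
(* Once the two inequalities have the same nonnegative constants, one minimum serves for both. This
   holds by substitution if all dual integrals over cubes are finite, and because both left sides
   vanish otherwise. *)
have [sb equiv] : strong_bound ps p mu w (K * B) /\ forall C, 0 <= C ->
    (strong_bound ps p mu w C <-> dual_strong_bound ps p mu w C).
  have [fin|] := pselect (forall i a (l : R), 0 < l ->
    (\int[lebesgue_Rn R n]_(x in cube a l) dual_weight (ps i) (w i) x < +oo)%E).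
    split; first exact: strong_bound_B'.
    have wpos i := weights_ae_gt0 hps mw w0 fin i.
    by move=> C C0; split; [exact: strong_bound_dual|exact: dual_bound_strong].
  move=> /existsNP[i /existsNP[a /existsNP[l /not_implyP[l0 /negP]]]].
  rewrite -leNgt leye_eq => /eqP Ioo.
  have mu0 := half_space_null hps mw w0 Bfin l0 Ioo.
  have sb0 C : 0 <= C -> strong_bound ps p mu w C.
    move=> C0 v f fL; rewrite half_space_norm_null// mule_ge0// prode_ge0// => j _.
    exact: poweR_ge0.
  have dsb0 C : 0 <= C -> dual_strong_bound ps p mu w C.
    move=> C0 v f fL; rewrite half_space_norm_null// mule_ge0// prode_ge0// => j _.
    exact: poweR_ge0.
  split; first by apply: sb0; rewrite mulr_ge0.
  by move=> C C0; split=> _; [exact: dsb0|exact: sb0].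
have KB0 : 0 <= K * B by rewrite mulr_ge0.
(* Statements (1) and (2) ask for a positive constant, while [K * B] may be 0. *)
have KB1 : strong_bound ps p mu w (K * B + 1).
  move=> f fL; apply: le_trans (sb f fL) _.
  rewrite lee_wpmul2r ?lee_fin ?lerDl// prode_ge0// => i _; exact: poweR_ge0.
have KB10 : 0 < K * B + 1 by rewrite ltr_wpDl.
have [N [N0 PN Nmin] NKB] : exists2 N, smallest_constant (strong_bound ps p mu w) N & N <= K * B.
  apply: smallest_constant_exists => // f fL.
  have X0 : (0 <= \prod_(i < m) weighted_norm (ps i) (fun x => (w i x)%:E) (f i))%E.
    by apply: prode_ge0 => i _; exact: poweR_ge0.
  rewrite X0 -ge0_fin_numE// prode_fin_num// => i _.
  by rewrite ge0_fin_numE ?poweR_ge0//; have [] := fL i.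
split.
- by exists (K * B + 1).
- by exists (K * B + 1); split => //; apply/equiv => //; exact: ltW.
- exists N, N; split => //.
    split => //; first exact/equiv.
    by move=> C C0 /equiv-/(_ C0); exact: Nmin.
  rewrite BE -EFinM lee_fin (le_trans NKB)// ler_wpM2r// lerDl//.
Qed.
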